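(* Let $D\subseteq\mathbb{R}^N$ be a bounded Lipschitz domain, let $s\in(0,1)$, let $A$ be an $N$-function, and suppose that $$\lim_{\varepsilon\to0+}\varepsilon\int_0^{\varepsilon^{-s}}\frac{A(z)}{z}\,dz=\beta\in\mathbb{R}.$$ Then: (1) if $\beta=0$, then both the fractional Orlicz Hardy inequality $FOHI(s,A)$ and the regional fractional Orlicz Poincaré inequality $RFOPI(s,A)$ fail in $D$, i.e. $H_{N,s,A}(D)=0$ and $P^1_{N,s,A}(D)=0$; (2) if $\beta\in(0,\infty)$, then $FOHI(s,A)$ fails in $D$, i.e. $H_{N,s,A}(D)=0$.
   Context: An $N$-function is a continuous convex function $A:[0,\infty)\to[0,\infty)$ with $A(t)>0$ for $t>0$, $\lim_{t\to0}A(t)/t=0$ and $\lim_{t\to\infty}A(t)/t=\infty$. A domain is a nonempty connected open set. A bounded domain $D\subset\mathbb{R}^N$ is Lipschitz if there are constants $r_0>0$ and $\mathrm{Lip}(D)<\infty$ such that for each $z\in\partial D$ there are a linear isometry $L_z:\mathbb{R}^N\to\mathbb{R}^N$ and a Lipschitz function $\phi_z:\mathbb{R}^{N-1}\to\mathbb{R}$ with Lipschitz constant at most $\mathrm{Lip}(D)$ such that $L_z(D)\cap B(L_z(z),r_0)=\{x=(\tilde x,x_N)\in\mathbb{R}^N: x_N>\phi_z(\tilde x)\}\cap B(L_z(z),r_0)$. For an open set $D\subsetneq\mathbb{R}^N$, $\delta_x=\delta_D(x):=\inf\{|x-y|:y\in D^c\}$. Define $$M_{W^{s,A}(D)}(f):=\iint_{D\times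 D}A\left(\frac{|f(x)-f(y)|}{|x-y|^s}\right)\frac{dx\,dy}{|x-y|^N},$$ $$H_{N,s,A}(D):=\inf_{f\in C_c^\infty(D),\,f\ne0}\frac{M_{W^{s,A}(D)}(f)}{\int_D A\left(|f(x)|/\delta_x^s\right)dx},\qquad P^1_{N,s,A}(D):=\inf_{f\in C_c^\infty(D),\,f\neq0}\frac{M_{W^{s,A}(D)}(f)}{\int_D A(|f(x)|)dx}.$$ $FOHI(s,A)$ holds in $D$ if $H_{N,s,A}(D)>0$; $RFOPI(s,A)$ holds in $D$ if $P^1_{N,s,A}(D)>0$. *)

(* Defs.v *)
From HB Require Import structures.
From mathcomp Require Import all_boot all_order all_algebra.
From mathcomp Require Import all_classical all_reals all_analysis.

Set Implicit Arguments.
Unset Strict Implicit.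
Unset Printing Implicit Defensive.

Import Order.TTheory GRing.Theory Num.Theory.
Import numFieldNormedType.Exports.

Local Open Scope classical_set_scope.
Local Open Scope ring_scope.

Section euclidean_space.
Context {R : realType}.

(* The library norm on ['rV[R]_N] is the sup norm; it is used below only through
   the topology (and bounded sets) it induces. *)
Definition enorm (N : nat) (x : 'rV[R]_N) : R :=
  Num.sqrt (\sum_(i < N) x 0 i ^+ 2).

Definition eball (N : nat) (c : 'rV[R]_N) (r : R) : set 'rV[R]_N :=
  [set x | enorm (x - c) < r].

Definition boundary (N : nat) (D : set 'rV[R]_N) : set 'rV[R]_N :=
  closure D `\` interior D.

Definition domain (N : nat) (D : set 'rV[R]_N) : Prop :=
  [/\ D !=set0, open D & connected D].

(* Dimension [n.+1]: [col' ord_max x] drops the last coordinate of [x]. *)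
Definition lipschitz_domain (n : nat) (D : set 'rV[R]_n.+1) : Prop :=
  domain D /\
  exists r0 Lip : R, 0 < r0 /\
    forall z, boundary D z ->
    exists (L : {linear 'rV[R]_n.+1 -> 'rV[R]_n.+1}) (phi : 'rV[R]_n -> R),
    [/\ forall x, enorm (L x) = enorm x,
        forall u v, `|phi u - phi v| <= Lip * enorm (u - v)
      & (L @` D) `&` eball (L z) r0 =
        [set x | phi (col' ord_max x) < x 0 ord_max] `&` eball (L z) r0].

(* delta_D(x), for D with nonempty complement *)
Definition dist_compl (N : nat) (D : set 'rV[R]_N) (x : 'rV[R]_N) : R :=
  inf [set enorm (x - y) | y in ~` D].

Fixpoint iter_partial (N : nat) (s : seq 'I_N) (f : 'rV[R]_N -> R) :
    'rV[R]_N -> R :=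
  if s is i :: s' then fun x => 'D_(delta_mx 0 i) (iter_partial s' f) x else f.

Definition smooth (N : nat) (f : 'rV[R]_N -> R) : Prop :=
  forall s : seq 'I_N, continuous (iter_partial s f) /\
    forall (i : 'I_N) x, derivable (iter_partial s f) x (delta_mx 0 i).

(* An element of C_c^oo(D) is represented by its extension by 0 to the whole
   space. *)
Definition Cc_infty (N : nat) (D : set 'rV[R]_N) : set ('rV[R]_N -> R) :=
  [set f | [/\ smooth f, compact (closure [set x | f x != 0])
             & closure [set x | f x != 0] `<=` D]].

End euclidean_space.

Section lebesgue_rV.
Context {R : realType}.

Section measurable_rV.
Variable N : nat.

Let coord (i : 'I_N) (x : 'rV[R]_N) : R := x 0 i.

Let rV_set0 : g_sigma_preimage coord set0.
Proof. exact: sigma_algebra0. Qed.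

Let rV_setC A : g_sigma_preimage coord A -> g_sigma_preimage coord (~` A).
Proof. exact: sigma_algebraC. Qed.

Let rV_bigcup (F : _^nat) : (forall i, g_sigma_preimage coord (F i)) ->
  g_sigma_preimage coord (\bigcup_i (F i)).
Proof. exact: sigma_algebra_bigcup. Qed.

(* The Borel sigma-algebra, generated by the coordinate functions. *)
HB.instance Definition _ := @isMeasurable.Build default_measure_display
  'rV[R]_N (g_sigma_preimage coord) rV_set0 rV_setC rV_bigcup.

Lemma measurable_coord (i : 'I_N) :
  measurable_fun [set: 'rV[R]_N] (fun x : 'rV[R]_N => x 0 i).
Proof.
move=> _ Y mY; rewrite setTI; apply: sub_sigma_algebra => /=.
rewrite -bigcup_seq/=; exists i => /=; first by rewrite mem_index_enum.
by exists Y => //; rewrite setTI.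
Qed.

Lemma measurable_fun_coordP d (T : measurableType d) (f : T -> 'rV[R]_N) :
  (forall i, measurable_fun [set: T] (fun t => f t 0 i)) ->
  measurable_fun [set: T] f.
Proof.
move=> mf.
suff : g_sigma_preimage (fun i => coord i \o f) `<=` measurable.
  rewrite g_sigma_preimage_comp => fS _ A mA.
  by apply: fS; exists A.
apply: smallest_sub; first exact: sigma_algebra_measurable.
rewrite -bigcup_seq; apply: bigcup_sub => i _ A [B mB <-].
exact: mf.
Qed.

End measurable_rV.

Definition cons_rV (N : nat) (p : measurableTypeR R * 'rV[R]_N) : 'rV[R]_N.+1 :=
  row_mx (const_mx p.1 : 'rV[R]_1) p.2.

Lemma measurable_cons_rV (N : nat) :
  measurable_fun [set: measurableTypeR R * 'rV[R]_N] (@cons_rV N).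
Proof.
apply: measurable_fun_coordP => i.
case: (split_ordP (i : 'I_(1 + N))) => j ->.
  rewrite (_ : (fun t => _) = fst); first exact: measurable_fst.
  apply/funext => t.
  exact: etrans (row_mxEl (const_mx t.1 : 'rV[R]_1) t.2 0 j) (mxE _ _ _ _).
rewrite (_ : (fun t => _) = (fun x : 'rV[R]_N => x 0 j) \o snd).
  by apply: measurableT_comp; [exact: measurable_coord|exact: measurable_snd].
apply/funext => t; exact: (row_mxEr (const_mx t.1 : 'rV[R]_1) t.2 0 j).
Qed.

Definition uncons_rV (N : nat) (x : 'rV[R]_N.+1) : measurableTypeR R * 'rV[R]_N :=
  (x 0 ord0, \row_i x 0 (lift ord0 i)).

Lemma cons_rVK (N : nat) : cancel (@cons_rV N) (@uncons_rV N).
Proof.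
move=> [a x]; rewrite /cons_rV /uncons_rV; congr pair => /=.
  rewrite (_ : ord0 = lshift N ord0 :> 'I_(1 + N)); last exact/val_inj.
  exact: etrans (row_mxEl (const_mx a : 'rV[R]_1) x 0 ord0) (mxE _ _ _ _).
apply/rowP => j; rewrite mxE.
rewrite (_ : lift ord0 j = rshift 1 j :> 'I_(1 + N)); last exact/val_inj.
exact: (row_mxEr (const_mx a : 'rV[R]_1) x 0 j).
Qed.

Lemma measurable_uncons_rV (N : nat) :
  measurable_fun [set: 'rV[R]_N.+1] (@uncons_rV N).
Proof.
apply/measurable_fun_pairP; split; first exact: measurable_coord.
apply: measurable_fun_coordP => i.
rewrite (_ : (fun t => _) = (fun x : 'rV[R]_N.+1 => x 0 (lift ord0 i))).
  exact: measurable_coord.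
by apply/funext => t; rewrite /= mxE.
Qed.

(* Lebesgue measure on R^N: the N-fold product of the one-dimensional one
   (the Dirac mass at the unique point if N = 0). *)
Fixpoint lebesgue_rV (N : nat) : set 'rV[R]_N -> \bar R :=
  match N with
  | 0 => dirac (0 : 'rV[R]_0)
  | N'.+1 =>
      pushforward (lebesgue_measure \x lebesgue_rV (N := N'))%E (@cons_rV N')
  end.

Section lebesgue_rV_step.
Variables (N : nat) (mu : {sigma_finite_measure set 'rV[R]_N -> \bar R}).

Let nu := pushforward (lebesgue_measure \x mu)%E (@cons_rV N).

Let preimageT_measurable A : measurable A -> measurable (@cons_rV N @^-1` A).
Proof.
by move=> mA; rewrite -[X in measurable X]setTI; exact: measurable_cons_rV.
Qed.

Let nu0 : nu set0 = 0%E.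
Proof. by rewrite /nu /pushforward preimage_set0 measure0. Qed.

Let nu_ge0 A : (0 <= nu A)%E.
Proof. by rewrite /nu /pushforward; apply: measure_ge0. Qed.

Let nu_sigma_additive : semi_sigma_additive nu.
Proof.
move=> F mF tF mUF; rewrite /nu /pushforward preimage_bigcup.
apply: measure_semi_sigma_additive.
- by move=> n; exact: preimageT_measurable.
- apply/trivIsetP => /= i j _ _ ij; rewrite -preimage_setI.
  by move/trivIsetP : tF => /(_ _ _ _ _ ij) ->//; rewrite preimage_set0.
- by rewrite -preimage_bigcup; exact: preimageT_measurable.
Qed.

HB.instance Definition _ := isMeasure.Build _ _ _ nu
  nu0 nu_ge0 nu_sigma_additive.

Let nu_sigma_finite : sigma_finite setT nu.
Proof.
have /sigma_finiteP[F [TF ndF Foo]] :=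
  sigma_finiteT (lebesgue_measure : {sigma_finite_measure set _ -> \bar R}).
have /sigma_finiteP[G [TG ndG Goo]] := sigma_finiteT mu.
exists (fun k => @uncons_rV N @^-1` (F k `*` G k)).
  rewrite -preimage_bigcup (_ : \bigcup_k _ = setT) ?preimage_setT//.
  apply/seteqP; split => // -[x y] _.
  have [i _ Fix] : (\bigcup_i F i) x by rewrite -TF.
  have [j _ Gjy] : (\bigcup_j G j) y by rewrite -TG.
  exists (maxn i j) => //; split => /=.
  - by move: x Fix; exact/subsetPset/ndF/leq_maxl.
  - by move: y Gjy; exact/subsetPset/ndG/leq_maxr.
move=> k; have [mFk Fkoo] := Foo k; have [mGk Gkoo] := Goo k; split.
  rewrite -[X in measurable X]setTI.
  by apply: measurable_uncons_rV => //; exact: measurableX.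
rewrite /nu /pushforward (_ : _ @^-1` _ = F k `*` G k); last first.
  by rewrite -comp_preimage (_ : _ \o _ = idfun)//; exact/funext/cons_rVK.
rewrite product_measure1E//; apply: lte_mul_pinfty => //.
by rewrite ge0_fin_numE//; exact: measure_ge0.
Qed.

HB.instance Definition _ :=
  Measure_isSigmaFinite.Build _ _ _ nu nu_sigma_finite.

Lemma lebesgue_rV_step :
  exists nu' : {sigma_finite_measure set 'rV[R]_N.+1 -> \bar R}, nu = nu'.
Proof. by exists nu. Qed.

End lebesgue_rV_step.

Lemma lebesgue_rV_bundled (N : nat) :
  exists mu : {sigma_finite_measure set 'rV[R]_N -> \bar R},
    lebesgue_rV (N := N) = mu.
Proof.
elim: N => [|N [mu muE]]; first by exists (dirac (0 : 'rV[R]_0)).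
by rewrite /= muE; exact: lebesgue_rV_step.
Qed.

Section lebesgue_rV_measure.
Variable N : nat.

Let mu0 : lebesgue_rV (N := N) set0 = 0%E.
Proof. by have [mu ->] := lebesgue_rV_bundled N; exact: measure0. Qed.

Let mu_ge0 A : (0 <= lebesgue_rV (N := N) A)%E.
Proof. by have [mu ->] := lebesgue_rV_bundled N; exact: measure_ge0. Qed.

Let mu_sigma_additive : semi_sigma_additive (@lebesgue_rV N).
Proof.
by have [mu ->] := lebesgue_rV_bundled N; exact: measure_semi_sigma_additive.
Qed.

HB.instance Definition _ := isMeasure.Build _ _ _ (@lebesgue_rV N)
  mu0 mu_ge0 mu_sigma_additive.

Let mu_sigma_finite : sigma_finite setT (@lebesgue_rV N).
Proof. by have [mu ->] := lebesgue_rV_bundled N; exact: sigma_finiteT. Qed.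

HB.instance Definition _ :=
  Measure_isSigmaFinite.Build _ _ _ (@lebesgue_rV N) mu_sigma_finite.

End lebesgue_rV_measure.

End lebesgue_rV.

Section orlicz.
Context {R : realType}.

(* [A] represents a function on [0, +oo[; its values at negative arguments are
   irrelevant. *)
Definition N_function (A : R -> R) : Prop :=
  [/\ {within `[0, +oo[, continuous A},
      convex_function (`[0, +oo[%classic : set R) A,
      0 <= A 0 /\ forall t, 0 < t -> 0 < A t,
      A t / t @[t --> 0^'+] --> 0
    & A t / t @[t --> +oo] --> +oo].

Variables (N : nat) (s : R) (A : R -> R) (D : set 'rV[R]_N).
Local Open Scope ereal_scope.

Local Notation leb := (@lebesgue_rV R N).

Definition modular (f : 'rV[R]_N -> R) : \bar R :=
  \int[leb \x leb]_(p in D `*` D)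
    (A (`|f p.1 - f p.2| / enorm (p.1 - p.2) `^ s)
      / enorm (p.1 - p.2) ^+ N)%:E.

(* For f nonzero in C_c^oo(D) the denominators are positive and finite. *)
Definition hardy_constant : \bar R :=
  ereal_inf [set modular f /
      \int[leb]_(x in D) (A (`|f x| / dist_compl D x `^ s))%:E
    | f in [set f | Cc_infty D f /\ f <> (fun=> 0%R)]].

Definition poincare_constant : \bar R :=
  ereal_inf [set modular f / \int[leb]_(x in D) (A `|f x|)%:E
    | f in [set f | Cc_infty D f /\ f <> (fun=> 0%R)]].

Definition FOHI : Prop := 0 < hardy_constant.

Definition RFOPI : Prop := 0 < poincare_constant.

End orlicz.

(* Main.v *)
Require Import Defs.
From HB Require Import structures.
From mathcomp Require Import all_boot all_order all_algebra.
From mathcomp Require Import all_classical all_reals all_analysis measurable_realfun.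
From mathcomp Require Import ring lra.

(**
Both constants are infima of quotients, so it suffices to exhibit test functions
whose quotients tend to 0.  These are smooth cutoffs [f] of [D] at a small scale
[h]: equal to 1 where the closed ball of radius [2 h] for the sup norm lies in [D],
with slope [O(1/h)].  Everything rests on the order of magnitude of their modular.

Upper bound ([modular_cutoff_le]).  A pair [(x, y)] contributes to the modular only
if [f x] and [f y] differ, so that one of the two points lies in the strip where
[f] is not 1.  For fixed [x], bound the difference by 1 and by [|x - y| / a],
with [a] proportional to [h]; the integral over [y] is then controlled by that of
[A (rho^(1-s) / a)] for [rho <= a] and of [A (rho^-s)] for [rho > a], against
[rho^-N], [rho = |x - y|].  In polar coordinates both would be multiples of the
integral of [A z / z] up to [a^-s].  Polar coordinates are avoided: [A z] is at
most twice the integral of [A w / w] over [[z, 2 z]], and after exchanging the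
integrals only the mass of [rho^-N] on shells of bounded aspect ratio is needed
([integral_shell_le], [integral_N_function_powR_le]).  The strip has volume
[O(h)] because the boundary, a finite union of Lipschitz graphs, is covered by
[O(h^-n)] cubes of side [O(h)] ([lipschitz_strip_le]); cubes may be taken parallel
to the axes, so the isometries of the charts need not preserve the measure.
Altogether the modular is at most a constant times [e] times the integral of
[A z / z] up to [e^-s], with [e] proportional to [h], and this tends to a multiple
of [beta].

Case [beta = 0].  The modulars tend to 0, whereas both denominators are bounded
below by the integral of a positive constant on a fixed cube inside [D]
([denominators_ge]).

Case [beta > 0].  The modulars stay bounded, and the Hardy denominators tend to
infinity.  Indeed [A z / z] is nondecreasing, so its primitive is at most [A]
([integral_N_function_div_le]), and the hypothesis gives [A (e^-s) >= c / e] for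
small [e] ([N_function_growth]).  Hence [A (1 / delta^s)] dominates [c / delta],
whose integral is infinite: on a line parallel to the first axis, [delta] is at
most the distance to the point where the line leaves [D]
([integral_hardy_density_pinfty]).  Fatou's lemma transfers this to the cutoffs
([hardy_denominator_near]).

The cutoffs themselves come from a lattice of mesh [h]: with a tensorised plateau
function at each node, take one minus the product of the complementary bumps over
the nodes whose box is contained in [D].  Only boundedly many bumps overlap, which
gives the Lipschitz bound uniformly in [h] ([cutoff_lipschitz]), and no
convolution is needed.
*)

Set Implicit Arguments.
Unset Strict Implicit.
Unset Printing Implicit Defensive.

Import Order.TTheory GRing.Theory Num.Theory.
Import numFieldNormedType.Exports.

Local Open Scope classical_set_scope.
Local Open Scope ring_scope.

(** * N-functions *)

Lemma measurable_invr (R : realType) : measurable_fun [set: R] (@GRing.inv R).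
Proof.
(* The square makes the base of the power nonnegative. *)
rewrite (_ : GRing.inv = (fun x : R => x * (x ^+ 2) `^ (-1))).
  apply: measurable_funM => //.
  rewrite (_ : (fun x => _) = @powR R ^~ (-1) \o (fun x => x ^+ 2))//.
  by apply: measurableT_comp; [exact: measurable_powR|exact: exprn_measurable].
apply/funext => x /=; rewrite powR_inv1 ?sqr_ge0//.
by have [->|x0] := eqVneq x 0; rewrite ?invr0 ?mul0r// expr2 invfM mulrA divff ?mul1r.
Qed.

Section N_function_theory.
Context {R : realType}.
Variables (A : R -> R).
Hypothesis AN : N_function A.

(** [A 0] is the right limit of [A t = (A t / t) * t], which vanishes. *)
Lemma N_function0 : A 0 = 0.
Proof.
have [cA _ _ A0 _] := AN.
have [_ A0'] := (continuous_within_itvcyP 0 A).1 cA.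
have : A t / t * t @[t --> 0^'+] --> (0 * 0 : R).
  by apply: cvgM => //; exact: cvg_at_right_filter.
rewrite mulr0 => A00; apply: (cvg_unique _ A0') => //.
apply: cvg_trans A00; apply: near_eq_cvg; near=> t.
by rewrite divfK// gt_eqF.
Unshelve. all: by end_near. Qed.

Lemma N_function_ge0 t : 0 <= t -> 0 <= A t.
Proof.
have [_ _ [A0 Agt0] _ _] := AN.
by rewrite le_eqVlt => /predU1P[<-//|/Agt0/ltW].
Qed.

(** This is convexity between [x] and 0, where [A] vanishes. *)
Lemma N_function_scale t x : 0 <= t <= 1 -> 0 <= x -> A (t * x) <= t * A x.
Proof.
move=> /andP[t0 t1] x0; have [_ cvxA _ _ _] := AN.
have : A (t * x + (1 - t) * 0) <= t * A x + (1 - t) * A 0.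
  by apply: (cvxA (Itv01 t0 t1)); rewrite inE/= in_itv/= ?lexx// x0.
by rewrite N_function0 !mulr0 !addr0.
Qed.

Lemma N_function_slope x y : 0 < x -> x <= y -> A x / x <= A y / y.
Proof.
move=> x0 xy; have y0 := lt_le_trans x0 xy.
rewrite ler_pdivrMr// -mulrA [_^-1 * _]mulrC [leRHS]mulrC.
rewrite -[X in A X](divfK (lt0r_neq0 y0)); apply: N_function_scale; last exact: ltW.
by rewrite divr_ge0 ?ler_pdivrMr ?mul1r// ltW.
Qed.

Lemma N_function_le x y : 0 <= x -> x <= y -> A x <= A y.
Proof.
rewrite le_eqVlt => /predU1P[<- y0|x0 xy].
  by rewrite N_function0 N_function_ge0.
have y0 := lt_le_trans x0 xy.
have := N_function_slope x0 xy; rewrite ler_pdivrMr// => /le_trans; apply.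
by rewrite mulrAC ler_pdivrMr// ler_wpM2l ?N_function_ge0// ltW.
Qed.

(** The truncation at 0 discards the values of [A] at negative arguments, about
    which nothing is known, and leaves a nondecreasing function. *)
Lemma N_function_measurable : measurable_fun [set: R] (A \o Num.max 0).
Proof.
apply: nondecreasing_measurable => // x y xy /=.
by apply: N_function_le; [rewrite le_max lexx|rewrite ge_max !le_max lexx xy orbT].
Qed.

Lemma N_function_measurable_comp d (T : measurableType d) (f : T -> R) :
  measurable_fun setT f -> (forall x, 0 <= f x) ->
  measurable_fun setT (fun x => A (f x)).
Proof.
move=> mf f0; rewrite (_ : (fun x => _) = (A \o Num.max 0) \o f).
  exact: measurableT_comp N_function_measurable mf.
by apply/funext => x /=; rewrite max_r.
Qed.

Lemma measurable_N_function_div : measurable_fun setT (fun w : R => A (Num.max 0 w) / w).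
Proof.
by apply: measurable_funM; [exact: N_function_measurable|exact: measurable_invr].
Qed.

Local Open Scope ereal_scope.

(** The average of [A w / w] over [[z, 2 z]] dominates, up to a constant, its
    value at the left end point; this turns pointwise bounds on [A] into
    integral ones without a change of variables. *)
Lemma N_function_le_integral (z : R) : (0 < z)%R ->
  (A z)%:E <= 2%:E * \int[lebesgue_measure]_(w in `[z, (2 * z)%R]) (A (Num.max 0%R w) / w)%:E.
Proof.
move=> z0.
have Az0 : (0 <= A z)%R by rewrite N_function_ge0// ltW.
have -> : (A z)%:E = 2%:E * \int[lebesgue_measure]_(w in `[z, (2 * z)%R]) (A z / (2 * z))%:E.
  rewrite integral_cst//= lebesgue_measure_itv/= lte_fin ifT; last by lra.
  by rewrite -EFinB -!EFinM; congr EFin; field; rewrite gt_eqF.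
rewrite lee_pmul2l//; apply: ge0_le_integral => //.
- by move=> w _; rewrite lee_fin divr_ge0//; lra.
- apply/measurable_EFinP; apply: measurable_funTS; exact: measurable_N_function_div.
- move=> w /=; rewrite in_itv/= => /andP[zw w2].
  have w0 : (0 < w)%R by lra.
  rewrite lee_fin max_r; last exact: ltW.
  apply: ler_pM => //; first by rewrite invr_ge0; lra.
    by apply: N_function_le => //; lra.
  by rewrite lef_pV2// posrE; lra.
Qed.

(** The slope [A w / w] is at most [A T / T] on the whole interval. *)
Lemma integral_N_function_div_le (T : R) : (0 < T)%R ->
  \int[lebesgue_measure]_(w in `]0%R, T]) (A w / w)%:E <= (A T)%:E.
Proof.
move=> T0.
have -> : (A T)%:E = \int[lebesgue_measure]_(w in `]0%R, T]) (A T / T)%:E.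
  rewrite integral_cst//= lebesgue_measure_itv/= lte_fin T0.
  by rewrite -EFinB -!EFinM; congr EFin; field; rewrite gt_eqF.
apply: ge0_le_integral => //.
- move=> w; rewrite /= in_itv/= => /andP[w0 _].
  by rewrite lee_fin divr_ge0 ?N_function_ge0// ltW.
- apply/measurable_EFinP.
  apply: (eq_measurable_fun (fun w : R => A (Num.max 0%R w) / w)%R).
    by move=> w; rewrite inE/= in_itv/= => /andP[w0 _]; rewrite max_r// ltW.
  by apply: measurable_funTS; exact: measurable_N_function_div.
- by move=> w /=; rewrite in_itv/= => /andP[w0 wT]; rewrite lee_fin N_function_slope.
Qed.

End N_function_theory.

(** * Euclidean norm, cubes and Lebesgue measure *)

Section euclidean_norm.
Context {R : realType} {N : nat}.
Implicit Types (x y c : 'rV[R]_N) (r : R).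

Lemma rV_subE x y i : (x - y) 0 i = x 0 i - y 0 i.
Proof. by rewrite !mxE. Qed.

Lemma norm_coord_le x i : `|x 0 i| <= `|x|.
Proof.
rewrite [leRHS]/Num.norm /= mx_normrE; apply/bigmax_geP; right => /=.
by exists (0, i).
Qed.

Lemma norm_rV_leP x r : 0 <= r -> reflect (forall i, `|x 0 i| <= r) (`|x| <= r).
Proof.
move=> r0; apply: (iffP idP) => [xr i|xr].
  exact: le_trans (norm_coord_le x i) xr.
rewrite [leLHS]/Num.norm /= mx_normrE; apply/bigmax_leP; split => // -[i j] _ /=.
by rewrite (ord1 i).
Qed.

Lemma enorm_ge0 x : 0 <= enorm x.
Proof. exact: sqrtr_ge0. Qed.

Lemma enormN x : enorm (- x) = enorm x.
Proof. by congr Num.sqrt; apply: eq_bigr => i _; rewrite mxE sqrrN. Qed.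

Lemma enorm_sub x y : enorm (x - y) = enorm (y - x).
Proof. by rewrite -enormN opprB. Qed.

Lemma enorm0 : enorm (0 : 'rV[R]_N) = 0.
Proof.
by rewrite /enorm big1 ?sqrtr0// => i _; rewrite mxE expr0n.
Qed.

Lemma norm_le_enorm x : `|x| <= enorm x.
Proof.
apply/norm_rV_leP => [|i]; first exact: enorm_ge0.
rewrite -sqrtr_sqr ler_wsqrtr// (bigD1 i)//= lerDl.
by apply: sumr_ge0 => j _; exact: sqr_ge0.
Qed.

Lemma enorm_le x : enorm x <= N%:R * `|x|.
Proof.
rewrite -[leRHS]ger0_norm ?mulr_ge0// -sqrtr_sqr ler_wsqrtr//.
apply: (@le_trans _ _ (\sum_(i < N) `|x| ^+ 2)).
  apply: ler_sum => i _; rewrite -real_normK ?num_real// lerXn2r ?nnegrE//.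
  exact: norm_coord_le.
rewrite sumr_const card_ord -[leLHS]mulr_natl exprMn ler_wpM2r ?sqr_ge0//.
by rewrite -natrX ler_nat; case: (N) => // m; rewrite expnS leq_pmulr.
Qed.

Lemma enorm_gt0 x : (0 < enorm x) = (x != 0).
Proof.
have [->|x0] := eqVneq; first by rewrite enorm0 ltxx.
by apply: lt_le_trans (norm_le_enorm x); rewrite normr_gt0.
Qed.

Lemma enorm_continuous : continuous (@enorm R N).
Proof.
have csum : continuous (fun x : 'rV[R]_N => \sum_(i < N) x 0 i ^+ 2); last first.
  by move=> x; apply: continuous_comp; [exact: csum|exact: sqrt_continuous].
have /= := @continuous_big R 'I_N +%R 0 xpredT (@add_continuous R).
apply => i _ z.
apply: (continuous_comp (f := fun y : 'rV[R]_N => y 0 i) (g := fun t : R => t ^+ 2)).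
  exact: coord_continuous.
exact: exprn_continuous.
Qed.

Lemma open_eball c r : open (eball c r).
Proof.
rewrite /eball (_ : [set x | _] = (fun x => enorm (x - c)) @^-1` [set t | t < r])//.
apply: (@open_comp _ _ (fun x => enorm (x - c)) [set t : R | t < r]); last exact: open_lt.
move=> x _; apply: (continuous_comp (f := fun y : 'rV[R]_N => y - c)); last exact: enorm_continuous.
by apply: (@continuousB _ _ _ id (cst c)) => //; exact: cst_continuous.
Qed.

Lemma measurable_enorm : measurable_fun [set: 'rV[R]_N] (@enorm R N).
Proof.
rewrite (_ : @enorm R N = @Num.sqrt R \o (fun x => \sum_(i < N) x 0 i ^+ 2))//.
apply: measurableT_comp.
  by apply: continuous_measurable_fun; exact: sqrt_continuous.
by apply: measurable_sum => i; apply: measurable_funX; exact: measurable_coord.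
Qed.

Lemma measurable_enorm_sub : measurable_fun [set: 'rV[R]_N * 'rV[R]_N]
  (fun p => enorm (p.1 - p.2)).
Proof.
apply: (measurableT_comp measurable_enorm).
apply: measurable_fun_coordP => i.
rewrite (_ : (fun p => _) = (fun p : 'rV[R]_N * 'rV[R]_N => p.1 0 i - p.2 0 i)).
  apply: measurable_funB; apply: (measurableT_comp (measurable_coord i)) => //.
by apply/funext => p; rewrite !mxE.
Qed.

(** The ambient norm is the sup norm, so that closed balls are products of
    intervals and their volume needs no computation. *)
Definition cube c r : set 'rV[R]_N := [set x | `|x - c| <= r].

Lemma measurable_cube c r : measurable (cube c r).
Proof.
have [r0|r0] := leP 0 r; last first.
  rewrite (_ : cube c r = set0)//; apply/seteqP; split => // x /=.
  by rewrite /cube/= leNgt (lt_le_trans r0)// normr_ge0.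
rewrite (_ : cube c r = \bigcap_(i in [set: 'I_N]) [set x | `|x 0 i - c 0 i| <= r]).
  apply: fin_bigcap_measurable => // i _.
  have : measurable_fun [set: 'rV[R]_N] (fun x => `|x 0 i - c 0 i|).
    apply: measurableT_comp => //; apply: measurable_funB => //.
    exact: measurable_coord.
  move=> /(_ measurableT `]-oo, r]%classic (measurable_itv _)).
  by rewrite setTI; congr measurable; apply/seteqP; split => x /=; rewrite in_itv.
apply/seteqP; split => x /=.
  by move=> /(norm_rV_leP _ r0) xr i _; have := xr i; rewrite !mxE.
by move=> xr; apply/(norm_rV_leP _ r0) => i; rewrite !mxE; exact: xr.
Qed.

(** Every open set is a countable union of cubes with rational data, hence
    belongs to the sigma-algebra generated by the coordinates. *)
Lemma open_rV_measurable (U : set 'rV[R]_N) : open U -> measurable U.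
Proof.
move=> oU.
pose q2r (p : 'rV[rat]_N) : 'rV[R]_N := map_mx ratr p.
pose F (p : 'rV[rat]_N * nat) : set 'rV[R]_N :=
  if pselect (cube (q2r p.1) p.2.+1%:R^-1 `<=` U) then cube (q2r p.1) p.2.+1%:R^-1
  else set0.
rewrite (_ : U = \bigcup_p F p).
  rewrite (_ : \bigcup_p F p = \bigcup_k if unpickle k is Some p then F p else set0).
    apply: bigcup_measurable => k _; case: (unpickle k) => // p.
    by rewrite /F; case: pselect => *; [exact: measurable_cube|exact: measurable0].
  apply/seteqP; split => [x [p _ Fp]|x [k _]].
    by exists (pickle p) => //; rewrite pickleK.
  by case: (unpickle k) => // p Fp; exists p.
apply/seteqP; split => [x Ux|x [p _]]; last first.
  by rewrite /F; case: pselect => // pU /pU.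
have : nbhs x U by exact: open_nbhs_nbhs.
rewrite -nbhs_ballE => -[e /= e0 xeU].
have [m me] : exists m, m.+1%:R^-1 < e / 2.
  have := @near_infty_natSinv_lt R (PosNum (divr_gt0 e0 (ltr0Sn R 1))).
  by case=> m _ /(_ m (leqnn m)); exists m.
have m0 : 0 < (m.+1%:R : R)^-1 by rewrite invr_gt0.
have /choice[p pP] i : exists q : rat, ratr q \in `](x 0 i - m.+1%:R^-1), (x 0 i + m.+1%:R^-1)[.
  by apply: rat_in_itvoo; rewrite ltrBlDr -addrA ltrDl addr_gt0.
have xp : cube (q2r (\row_i p i)) m.+1%:R^-1 x.
  apply/norm_rV_leP => [|i]; first exact: ltW.
  have := pP i; rewrite in_itv/= !mxE ler_distl => /andP[xq qx].
  by rewrite lerBlDr ltW//= -lerBlDr ltW.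
exists (\row_i p i, m) => //; rewrite /F; case: pselect => // -[] /=.
move=> y yp; apply: xeU; rewrite -ball_normE /=.
rewrite -(subrK (q2r (\row_i p i)) x) -addrA (le_lt_trans (ler_normD _ _))//.
rewrite (splitr e) ler_ltD// ?(le_trans xp) ?(ltW me)//.
by rewrite distrC (le_lt_trans yp).
Qed.

(** Stated through sublevel sets because the distance to the complement is
    naturally an infimum of continuous functions. *)
Lemma measurable_fun_open_lt (f : 'rV[R]_N -> R) :
  (forall r, open [set x | f x < r]) -> measurable_fun setT f.
Proof.
move=> of_; apply: (measurability _ (RGenInftyO.measurableE R)) => /=.
move=> _ [_ [r ->] <-]; rewrite setTI; apply: open_rV_measurable.
have := of_ r; congr open; apply/seteqP; split => x /=; by rewrite in_itv.
Qed.

End euclidean_norm.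

Section cons_rV_theory.
Context {R : realType} {N : nat}.
Implicit Types (t : measurableTypeR R) (x : 'rV[R]_N) (c : 'rV[R]_N.+1).

Lemma cons_rV0 t x : cons_rV (t, x) 0 ord0 = t.
Proof. exact: (congr1 fst (cons_rVK (t, x))). Qed.

Lemma cons_rVS t x i : cons_rV (t, x) 0 (lift ord0 i) = x 0 i.
Proof.
by have /rowP/(_ i) := congr1 snd (cons_rVK (t, x)); rewrite mxE.
Qed.

Lemma cube_cons_rV c r t x : (0 <= r) ->
  cube c r (cons_rV (t, x)) <->
  `|t - c 0 ord0| <= r /\ cube (uncons_rV c).2 r x.
Proof.
move=> r0; split.
  move=> /(norm_rV_leP _ r0) xr; split.
    by have := xr ord0; rewrite rV_subE cons_rV0.
  by apply/(norm_rV_leP _ r0) => i; have := xr (lift ord0 i);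
    rewrite !rV_subE cons_rVS [(uncons_rV c).2 0 i]mxE.
move=> [tr /(norm_rV_leP _ r0) xr]; apply/(norm_rV_leP _ r0) => i.
case: (unliftP ord0 i) => [j|] ->.
  by have := xr j; rewrite !rV_subE cons_rVS [(uncons_rV c).2 0 j]mxE.
by rewrite rV_subE cons_rV0.
Qed.

End cons_rV_theory.

Section lebesgue_rV_theory.
Context {R : realType}.
Local Notation leb := (@lebesgue_rV R _).
Local Open Scope ereal_scope.

Lemma lebesgue_rV_cube N (c : 'rV[R]_N) r : (0 <= r)%R ->
  leb (cube c r) = ((2 * r) ^+ N)%:E.
Proof.
move=> r0; elim: N c => [|N IH] c.
  rewrite /= diracE mem_set ?expr0//.
  by apply/(norm_rV_leP _ r0) => -[].
transitivity ((lebesgue_measure \x @lebesgue_rV R N)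
   ((`[(c 0 ord0 - r)%R, (c 0 ord0 + r)%R]%classic : set (measurableTypeR R)) `*`
      cube (uncons_rV c).2 r)).
  rewrite /= /pushforward; congr (_ _); apply/seteqP; split => -[t x] /=.
    by move=> /(cube_cons_rV _ _ _ r0)[tr xr]; rewrite in_itv/= -ler_distl.
  rewrite in_itv/= -ler_distl => tx; exact/(cube_cons_rV _ _ _ r0).
rewrite product_measure1E//; last exact: measurable_cube.
rewrite [X in _ * X]IH exprS EFinM; congr (_ * _).
rewrite [LHS]lebesgue_measure_itv/= lte_fin.
case: ifPn => [_|]; first by rewrite -EFinB; congr EFin; lra.
by rewrite -leNgt => ?; congr EFin; lra.
Qed.

(** Tonelli's theorem along lines parallel to the first axis. *)
Lemma ge0_integral_lebesgue_rVS N (f : 'rV[R]_N.+1 -> \bar R) :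
  measurable_fun setT f -> (forall x, 0 <= f x) ->
  \int[leb]_x f x =
  \int[leb]_(x in [set: 'rV[R]_N]) \int[lebesgue_measure]_t f (cons_rV (t, x)).
Proof.
move=> mf f0.
have -> : \int[leb]_x f x =
    \int[lebesgue_measure \x @lebesgue_rV R N]_p (f \o @cons_rV R N) p.
  exact: (ge0_integral_pushforward (@measurable_cons_rV R N)
    (lebesgue_measure \x @lebesgue_rV R N) measurableT mf (fun y _ => f0 y)).
rewrite fubini_tonelli2//; last by move=> p; exact: f0.
exact: (measurableT_comp mf (@measurable_cons_rV R N)).
Qed.

End lebesgue_rV_theory.

(** * Integrals of N-functions of a power of the distance *)

Section shells.
Context {R : realType}.
Local Notation leb := (@lebesgue_rV R _).
Local Open Scope ereal_scope.

Lemma measurable_enorm_subr N (x : 'rV[R]_N) :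
  measurable_fun [set: 'rV[R]_N] (fun y => enorm (x - y)%R).
Proof.
exact: (measurableT_comp (@measurable_enorm_sub R N) (pair1_measurable x)).
Qed.

Lemma measurable_enorm_expV N (x : 'rV[R]_N) :
  measurable_fun [set: 'rV[R]_N] (fun y => (enorm (x - y) ^+ N)^-1)%R.
Proof.
apply: (measurableT_comp (@measurable_invr R)).
by apply: measurable_funX; exact: measurable_enorm_subr.
Qed.

(** The singularity [|x - y|^-N] has bounded mass on every shell of bounded
    aspect ratio, whatever its size; this replaces polar coordinates. *)
Lemma integral_shell_le N (x : 'rV[R]_N) (X : set 'rV[R]_N) (c : R) :
  measurable X -> (0 <= c)%R -> (forall y, X y -> 0 < enorm (x - y))%R ->
  (forall y y', X y -> X y' -> enorm (x - y') <= c * enorm (x - y))%R ->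
  \int[leb]_(y in X) ((enorm (x - y) ^+ N)^-1)%:E <= ((2 * c ^+ 2) ^+ N)%:E.
Proof.
move=> mX c0 X0 Xc.
have K0 : 0 <= ((2 * c ^+ 2) ^+ N)%:E by rewrite lee_fin exprn_ge0// mulr_ge0// sqr_ge0.
have [->|/set0P[y Xy]] := eqVneq X set0; first by rewrite integral_set0.
(* The radius [r] of any point of the shell serves as reference: all radii lie
   between [r / c] and [c r], whence the square of [c] in the bound. *)
set r := enorm (x - y); have r0 : (0 < r)%R by exact: X0.
have c_gt0 : (0 < c)%R.
  by rewrite -(pmulr_lgt0 c r0); apply: lt_le_trans (Xc y y Xy Xy).
apply: (@le_trans _ _ (\int[leb]_(y in X) (((r / c) ^+ N)^-1)%:E)).
  apply: ge0_le_integral => //.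
  - by move=> z Xz; rewrite lee_fin invr_ge0 exprn_ge0// enorm_ge0.
  - by apply/measurable_EFinP; apply: measurable_funTS; exact: measurable_enorm_expV.
  - move=> z Xz; rewrite lee_fin lef_pV2 ?posrE ?exprn_gt0 ?divr_gt0 ?X0//.
    rewrite lerXn2r ?nnegrE ?enorm_ge0//; first by rewrite divr_ge0// ltW.
    by rewrite ler_pdivrMr// mulrC; exact: Xc.
rewrite integral_cst//.
apply: (@le_trans _ _ ((((r / c) ^+ N)^-1)%:E * leb (cube x (c * r)))).
  apply: lee_pmul => //; first by rewrite lee_fin invr_ge0 exprn_ge0// divr_ge0// ltW.
  apply: le_measure; rewrite ?inE//; first exact: measurable_cube.
  move=> z Xz; rewrite /cube/= distrC; apply: le_trans (norm_le_enorm _) _.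
  exact: Xc.
rewrite lebesgue_rV_cube; last by rewrite mulr_ge0// ltW.
rewrite -EFinM lee_fin -exprVn -exprMn lerXn2r ?nnegrE//.
- by rewrite mulr_ge0// ?invr_ge0 ?divr_ge0 ?mulr_ge0// ltW.
- by rewrite mulr_ge0// sqr_ge0.
- by rewrite le_eqVlt; apply/orP; left; apply/eqP; field; rewrite !gt_eqF.
Qed.

Lemma measurable_powR_enorm N (x : 'rV[R]_N) (l q : R) :
  measurable_fun [set: 'rV[R]_N] (fun y => l * enorm (x - y) `^ q)%R.
Proof.
apply: measurable_funM => //.
apply: (measurableT_comp (@measurable_powR R q)).
exact: measurable_enorm_subr.
Qed.

(** For positive and negative exponents alike, the shells
    [w / 2 <= l rho^q <= w] have an aspect ratio depending on [q] only. *)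
Lemma powR_ratio (q a b : R) : (q != 0 -> 0 < a -> 0 < b ->
  a `^ q <= 2 * b `^ q -> b `^ q <= 2 * a `^ q -> a <= 2 `^ `|q|^-1 * b)%R.
Proof.
move=> q0 a0 b0 ab ba.
have nq0 : (0 < `|q|)%R by rewrite normr_gt0.
have key : (a `^ `|q| <= 2 * b `^ `|q|)%R.
  have [q_ge0|q_lt0] := leP 0%R q; first by rewrite ger0_norm.
  (* For a negative exponent the two hypotheses exchange their roles. *)
  rewrite ltr0_norm// !powRN ler_pdivlMr ?powR_gt0// mulrC ler_pdivrMr ?powR_gt0//.
have -> : a = ((a `^ `|q|) `^ `|q|^-1)%R.
  by rewrite -powRrM divff ?gt_eqF// powRr1// ltW.
rewrite [X in (_ <= _ * X)%R](_ : b = ((b `^ `|q|) `^ `|q|^-1)%R); last first.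
  by rewrite -powRrM divff ?gt_eqF// powRr1// ltW.
rewrite -powRM ?powR_ge0//.
by apply: ge0_ler_powR; rewrite ?nnegrE ?invr_ge0 ?mulr_ge0 ?powR_ge0.
Qed.

Variables (A : R -> R).
Hypothesis AN : N_function A.

(** Twice the bound of [integral_shell_le] for the aspect ratio
    [2^(1/|q|)]; the factor 2 comes from [N_function_le_integral]. *)
Definition shell_const (N : nat) (q : R) : R :=
  (2 * (2 * (2 `^ `|q|^-1) ^+ 2) ^+ N)%R.

Lemma shell_const_ge0 N q : (0 <= shell_const N q)%R.
Proof. by rewrite mulr_ge0// exprn_ge0// mulr_ge0// sqr_ge0. Qed.

(** Averaging [A] over [[z, 2 z]] with [z = l rho^q] and exchanging the
    integrals leaves, for each level [w], a shell of bounded aspect ratio. *)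
Lemma integral_N_function_powR_le n (x : 'rV[R]_n.+1) (l q T : R) :
  (q != 0)%R -> (0 < l)%R -> (0 < T)%R ->
  \int[leb]_y (if (l * enorm (x - y) `^ q <= T)%R then
      A (l * enorm (x - y) `^ q) / enorm (x - y) ^+ n.+1 else 0%R)%:E <=
  (shell_const n.+1 q)%:E *
    \int[lebesgue_measure]_(w in `]0%R, (2 * T)%R]) (A w / w)%:E.
Proof.
move=> q0 l0 T0; set N := n.+1.
pose rho (y : 'rV[R]_N) := enorm (x - y).
pose z (y : 'rV[R]_N) := (l * rho y `^ q)%R.
have mrho : measurable_fun setT rho by exact: measurable_enorm_subr.
have mz : measurable_fun setT z by exact: measurable_powR_enorm.
have z0 y : (0 <= z y)%R by rewrite mulr_ge0 ?powR_ge0// ltW.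
pose P (p : 'rV[R]_N * measurableTypeR R) : bool :=
  ((0 < p.2) && (p.2 <= 2 * T) && (z p.1 <= p.2) && (p.2 <= 2 * z p.1)
   && (0 < rho p.1))%R.
pose g (p : 'rV[R]_N * measurableTypeR R) : \bar R :=
  (if P p then A (Num.max 0 p.2) / p.2 * (rho p.1 ^+ N)^-1 else 0)%R%:E.
have mz1 : measurable_fun setT (fun p : 'rV[R]_N * measurableTypeR R => z p.1).
  exact: (measurableT_comp mz).
have mrho1 : measurable_fun setT (fun p : 'rV[R]_N * measurableTypeR R => rho p.1).
  exact: (measurableT_comp mrho).
have msnd : measurable_fun setT (fun p : 'rV[R]_N * measurableTypeR R => p.2 : R).
  exact: measurable_snd.
have mP1 : measurable_fun setT P.
  repeat apply: measurable_and.
  - exact: measurable_fun_ltr.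
  - exact: measurable_fun_ler.
  - exact: measurable_fun_ler.
  - by apply: measurable_fun_ler => //; apply: measurable_funM.
  - exact: measurable_fun_ltr.
have mg : measurable_fun setT g.
  apply/measurable_EFinP; apply: measurable_fun_ifT => //.
  apply: measurable_funM.
    exact: (measurableT_comp (measurable_N_function_div AN) msnd).
  apply: (measurableT_comp (@measurable_invr R)).
  exact: measurable_funX.
have g0 p : 0 <= g p.
  rewrite lee_fin; case: ifPn => // /andP[/andP[/andP[/andP[p0 _] _] _] _].
  rewrite mulr_ge0 ?invr_ge0 ?exprn_ge0 ?enorm_ge0// divr_ge0 ?(ltW p0)//.
  by rewrite N_function_ge0// le_max lexx.
have mF : measurable_fun setT (fun y => \int[lebesgue_measure]_w g (y, w)).
  exact: (measurable_fun_fubini_tonelli_F g).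
apply: (@le_trans _ _ (\int[leb]_y (2%:E * \int[lebesgue_measure]_w g (y, w)))).
  apply: ge0_le_integral => //.
  - move=> y _; case: ifPn => // _; rewrite lee_fin divr_ge0 ?exprn_ge0 ?enorm_ge0//.
    exact: (N_function_ge0 AN (z0 y)).
  - apply/measurable_EFinP; apply: measurable_fun_ifT => //.
      exact: measurable_fun_ler.
    apply: measurable_funM; last exact: measurable_enorm_expV.
    exact: (N_function_measurable_comp AN mz).
  - exact: measurable_funeM.
  move=> y _; have I0 : 0 <= 2%:E * \int[lebesgue_measure]_w g (y, w).
    by rewrite mule_ge0// integral_ge0.
  case: ifPn => // zT.
  have [r0|] := boolP (0 < rho y)%R; last first.
    rewrite -leNgt => r0; have -> : enorm (x - y) = 0%R.
      by apply/eqP; rewrite eq_le r0 enorm_ge0.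
    by rewrite powR0// mulr0 N_function0// mul0r.
  have zy0 : (0 < z y)%R by rewrite mulr_gt0// powR_gt0.
  have -> : \int[lebesgue_measure]_w g (y, w) =
      \int[lebesgue_measure]_(w in `[z y, (2 * z y)%R])
        (((rho y ^+ N)^-1)%:E * (A (Num.max 0 w) / w)%R%:E).
    rewrite [RHS]integral_mkcond; apply: eq_integral => w _.
    rewrite patchE mem_setE in_itv/= /g /P/= r0 andbT.
    have [zw|_] := leP (z y) w; last by rewrite andbF.
    have [w2|_] := leP w (2 * z y)%R; last by rewrite !andbF.
    rewrite (lt_le_trans zy0 zw) (le_trans w2) ?ler_pM2l//=.
    by rewrite -EFinM mulrC.
  rewrite ge0_integralZl//; last 3 first.
  - by apply/measurable_EFinP; apply: measurable_funTS; exact: measurable_N_function_div.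
  - move=> w /=; rewrite in_itv/= => /andP[zw _]; rewrite lee_fin divr_ge0//.
      by rewrite N_function_ge0// le_max lexx.
    exact: le_trans zw.
  - by rewrite lee_fin invr_ge0 exprn_ge0// enorm_ge0.
  rewrite muleCA mulrC EFinM; apply: lee_wpmul2l.
    by rewrite lee_fin invr_ge0 exprn_ge0// enorm_ge0.
  exact: N_function_le_integral.
rewrite ge0_integralZl//; last by move=> y _; apply: integral_ge0.
rewrite (fubini_tonelli g)// /shell_const EFinM -muleA lee_pmul2l//.
set C := ((2 * _) ^+ N)%R.
have C0 : (0 <= C)%R by rewrite exprn_ge0// mulr_ge0// sqr_ge0.
have mAw : measurable_fun `]0%R, (2 * T)%R] (fun w : R => (A w / w)%R%:E).
  apply/measurable_EFinP.
  apply: (eq_measurable_fun (fun w : R => A (Num.max 0%R w) / w)%R).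
    by move=> w; rewrite inE/= in_itv/= => /andP[w0 _]; rewrite max_r// ltW.
  by apply: measurable_funTS; exact: measurable_N_function_div.
have Aw0 (w : R) : `]0%R, (2 * T)%R]%classic w -> 0 <= (A w / w)%R%:E.
  rewrite /= in_itv/= => /andP[w0 _].
  by rewrite lee_fin divr_ge0 ?N_function_ge0// ltW.
rewrite -ge0_integralZl// [leRHS]integral_mkcond; apply: ge0_le_integral => //.
- by move=> w _; apply: integral_ge0.
- exact: (measurable_fun_fubini_tonelli_G g).
- by apply/(measurable_restrictT _ _).1 => //; exact: measurable_funeM.
move=> w _; rewrite patchE mem_setE in_itv/=; case: ifPn => [/andP[w0 wT]|w0T]; last first.
  by rewrite integral0_eq// => y _; rewrite /g/= /P/= (negbTE w0T).
pose X := [set y | P (y, w)].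
have mX : measurable X.
  have mP : measurable_fun setT (fun y => P (y, w)) by exact: (measurableT_comp mP1).
  by have := mP measurableT [set true] I; rewrite setTI.
have -> : \int[leb]_y g (y, w) =
    \int[leb]_(y in X) ((A w / w)%R%:E * ((rho y ^+ N)^-1)%R%:E).
  rewrite [RHS]integral_mkcond; apply: eq_integral => y _.
  rewrite patchE /g; case: ifPn => Py; last by rewrite memNset//; exact/negP.
  by rewrite mem_set// -EFinM max_r// ltW.
rewrite ge0_integralZl//; last 3 first.
- by apply/measurable_EFinP; apply: measurable_funTS; exact: measurable_enorm_expV.
- by move=> y _; rewrite lee_fin invr_ge0 exprn_ge0// enorm_ge0.
- by apply: Aw0; rewrite /= in_itv/= w0.
rewrite muleC; apply: lee_wpmul2r; first by apply: Aw0; rewrite /= in_itv/= w0.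
apply: (@integral_shell_le N x X (2 `^ `|q|^-1)) => //.
  by move=> y /andP[].
move=> y y' /=; rewrite /X/= /P/= => /andP[/andP[/andP[_ zw] wz] ry].
move=> /andP[/andP[/andP[_ zw'] wz'] ry'].
apply: powR_ratio q0 ry' ry _ _.
  have := le_trans zw' wz; rewrite /z mulrCA ler_pM2l//.
by have := le_trans zw wz'; rewrite /z mulrCA ler_pM2l//.
Qed.

End shells.

(** * Smooth functions and a plateau on the line *)

Section iterated_derivatives.
Context {R : realType}.

(** [f] is [n] times continuously differentiable along the directions [e i];
    with [V = R] and the single direction [1] this is the class C^n, with
    [V = R^N] and the canonical basis it is the notion of regularity asked for
    test functions.  Induction on [n] makes the closure properties immediate. *)
Fixpoint Cn (V : normedModType R) (I : Type) (e : I -> V) n (f : V -> R) : Prop :=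
  continuous f /\
  if n is n'.+1 then
    forall i, exists g, (forall x, is_derive x (e i) f (g x)) /\ Cn e n' g
  else True.

Section closure.
Variables (V : normedModType R) (I : Type) (e : I -> V).
Implicit Types f g : V -> R.

Lemma Cn_continuous n f : Cn e n f -> continuous f.
Proof. by case: n => [|n] []. Qed.

Lemma CnW n f : Cn e n.+1 f -> Cn e n f.
Proof.
elim: n f => [|n IH] f [cf df]; split => // i.
by have [g [fg gn]] := df i; exists g; split => //; exact: IH.
Qed.

Lemma Cn_cst n (a : R) : Cn e n (cst a).
Proof.
elim: n a => [|n IH] a; split => //; try exact: cst_continuous.
by move=> i; exists (cst 0); split => // x; exact: is_derive_cst.
Qed.

Lemma CnD n f g : Cn e n f -> Cn e n g -> Cn e n (fun x => f x + g x).
Proof.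
elim: n f g => [|n IH] f g [cf df] [cg dg].
  by split => // x; apply: cvgD; [exact: cf|exact: cg].
split => [x|i]; first by apply: cvgD; [exact: cf|exact: cg].
have [f' [ff' fn]] := df i; have [g' [gg' gn]] := dg i.
by exists (fun x => f' x + g' x); split; [move=> x; exact: is_deriveD|exact: IH].
Qed.

Lemma CnM n f g : Cn e n f -> Cn e n g -> Cn e n (fun x => f x * g x).
Proof.
elim: n f g => [|n IH] f g.
  by move=> [cf _] [cg _]; split => // x; apply: cvgM; [exact: cf|exact: cg].
move=> Cf Cg; have [cf df] := Cf; have [cg dg] := Cg.
split => [x|i]; first by apply: cvgM; [exact: cf|exact: cg].
have [f' [ff' fn]] := df i; have [g' [gg' gn]] := dg i.
exists (fun x => f x * g' x + g x * f' x); split; first by move=> x; exact: is_deriveM.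
by apply: CnD; apply: IH => //; exact: CnW.
Qed.

Lemma CnN n f : Cn e n f -> Cn e n (fun x => - f x).
Proof.
move=> Cf; rewrite (_ : (fun x => - f x) = (fun x => cst (-1) x * f x)).
  by apply: CnM => //; exact: Cn_cst.
by apply/funext => x; rewrite mulN1r.
Qed.

Lemma Cn_prod n (J : Type) (s : seq J) (P : pred J) (F : J -> V -> R) :
  (forall j, Cn e n (F j)) -> Cn e n (fun x => \prod_(j <- s | P j) F j x).
Proof.
move=> CF; elim: s => [|j s IH].
  by under eq_fun do rewrite big_nil; exact: Cn_cst.
under eq_fun do rewrite big_cons.
by case: (P j) => //; exact: CnM.
Qed.

(** The derivative [- f^-2 f'] involves only [f^-1] and [f'], to which the
    induction hypothesis applies. *)
Lemma CnV n f : (forall x, f x != 0) -> Cn e n f -> Cn e n (fun x => (f x)^-1).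
Proof.
move=> f0; elim: n f f0 => [|n IH] f f0.
  by move=> [cf _]; split => // x; apply: cvgV => //; exact: cf.
move=> Cf; have [cf df] := Cf; split => [x|i].
  by apply: cvgV => //; exact: cf.
have [f' [ff' fn]] := df i.
exists (fun x => - ((f x)^-1 * (f x)^-1 * f' x)); split.
  move=> x; have [dfx f'x] := ff' x.
  apply: DeriveDef; first exact: (derivableV (f0 x) dfx).
  by rewrite (deriveV (f0 x) dfx) f'x expr2 invfM scaleNr.
by apply/CnN/CnM => //; apply: CnM; apply: IH => //; exact: CnW.
Qed.

End closure.

(** Directional derivatives commute with affine changes of variable, as the two
    difference quotients are the same function. *)
Lemma Cn_comp_affine (V : normedModType R) (I : Type) (e : I -> V) n
    (F : R -> R) (h : V -> R) (c : I -> R) :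
  continuous h -> (forall i t x, h (t *: e i + x) = t * c i + h x) ->
  Cn (fun _ : unit => 1 : R) n F -> Cn e n (F \o h : V -> R).
Proof.
move=> ch hc; elim: n F => [|n IH] F CF.
  split => // x; apply: continuous_comp; [exact: ch|exact: (Cn_continuous CF)].
have [cF dF] := CF; split => [x|i].
  by apply: continuous_comp; [exact: ch|exact: cF].
have [G [FG Gn]] := dF tt.
exists (fun x => c i * G (h x)); split; last first.
  by apply: CnM; [exact: Cn_cst|exact: IH].
move=> x; have [dFx Fx] := FG (h x).
have difF : differentiable F (h x) by exact/derivable1_diffP.
have dc : is_derive (h x) (c i) F (c i * G (h x)).
  apply: DeriveDef; first exact: diff_derivable.
  rewrite deriveE// -[X in 'd F _ X]mulr1 -[_ * 1]/(c i *: 1) linearZ/=.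
  by rewrite -deriveE// Fx.
have E : (fun t : R => t^-1 *: (((F \o h) \o shift x) (t *: e i) - (F \o h) x)) =
    (fun t : R => t^-1 *: ((F \o shift (h x)) (t *: c i) - F (h x))).
  by apply/funext => t /=; rewrite hc.
by have [d1 d2] := dc; apply: DeriveDef; rewrite /derivable/derive E.
Qed.

(** The functions [P(1/x) exp(-1/x)], extended by 0 to the left of 0, form a
    family stable under differentiation. *)
Definition flat (P : {poly R}) (x : R) : R :=
  if 0 < x then P.[x^-1] * expR (- x^-1) else 0.

(** The exponential series dominates its term of degree [size P + 2]; the two
    spare powers of [t] make [flat P] quadratically small at 0. *)
Lemma horner_le_exp (P : {poly R}) : exists2 M : R, 0 <= M &
  forall t : R, 1 <= t -> `|P.[t]| <= M * t ^- 2 * expR t.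
Proof.
pose S := \sum_(i < size P) `|P`_i|; set m := size P.
have S0 : 0 <= S by exact: sumr_ge0.
exists (S * (m.+2)`!%:R) => [|t t1]; first by rewrite mulr_ge0.
have t0 : 0 < t by exact: lt_le_trans t1.
have : `|P.[t]| <= S * t ^+ m.
  rewrite horner_coef mulr_suml; apply: le_trans (ler_norm_sum _ _ _) _.
  apply: ler_sum => i _; rewrite normrM ler_wpM2l// normrX ger0_norm ?(ltW t0)//.
  by apply: ler_weXn2l => //; exact: ltnW.
move=> /le_trans; apply; rewrite -!mulrA ler_wpM2l//.
have : t ^+ m.+2 / (m.+2)`!%:R <= expR t.
  have := @expR_ge1Dxn R t m.+1 (ltW t0); apply: le_trans; rewrite lerDr//.
rewrite ler_pdivrMr ?ltr0n ?fact_gt0// [X in _ <= X -> _]mulrC => tm.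
rewrite mulrCA -ler_pdivrMl ?invr_gt0 ?exprn_gt0// invrK.
by rewrite -exprD add2n.
Qed.

Lemma flat_sq_le (P : {poly R}) : exists2 M : R, 0 <= M &
  forall x : R, x <= 1 -> `|flat P x| <= M * x ^+ 2.
Proof.
have [M M0 PM] := horner_le_exp P; exists M => // x x1.
rewrite /flat; case: ifPn => x0; last by rewrite normr0 mulr_ge0// sqr_ge0.
rewrite normrM (gtr0_norm (expR_gt0 _)) expRN ler_pdivrMr ?expR_gt0//.
have := PM x^-1; rewrite exprVn invrK; apply.
by rewrite invf_ge1.
Qed.

Lemma is_derive_flat (P : {poly R}) (x : R) :
  is_derive x (1 : R) (flat P) (flat ('X^2 * (P - P^`())) x).
Proof.
have [x0|x0|->] := ltgtP x 0.
- rewrite {2}/flat ltNge (ltW x0)/=; apply: (@near_eq_is_derive _ _ _ (cst 0)).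
  near=> y; rewrite /flat ltNge ifN// negbK.
  by apply: ltW; near: y; exact: lt_nbhsl.
- rewrite {2}/flat x0.
  apply: (@near_eq_is_derive R R R (fun y : R => P.[y^-1] * expR (- y^-1))).
    near=> y; rewrite /flat ifT//; near: y; exact: lt_nbhsr.
  have dV : is_derive x (1 : R) (fun y : R => y^-1) (- x ^- 2).
    apply: is_derive_eq; first exact: (is_deriveV (lt0r_neq0 x0) (is_derive_id x 1)).
    by rewrite -[RHS]mulr1.
  have dP := @is_derive1_comp R (horner P) (fun y => y^-1) x _ _
    (is_derive_poly P x^-1) dV.
  have dE := @is_derive1_comp R expR (fun y => - y^-1) x _ _
    (is_derive_expR (- x^-1)) (is_deriveN dV).
  have dPE : is_derive x (1 : R) (fun y : R => P.[y^-1] * expR (- y^-1)) _ := is_deriveM dP dE.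
  apply: (is_derive_eq dPE).
  rewrite /= !hornerE -exprVn -![_ *: _]/(_ * _).
  ring.
- have [M M0 flM] := flat_sq_le P.
  have f0 : flat P 0 = 0 by rewrite /flat ltxx.
  have q0 : (fun t : R => t^-1 *: ((flat P \o shift 0) (t *: 1) - flat P 0)) @ 0^' --> (0 : R).
    apply/cvgr0Pnorm_lt => eps eps0; near=> t.
    have t0 : t != 0 by near: t; exact: nbhs_dnbhs_neq.
    have nt0 : 0 < `|t| by rewrite normr_gt0.
    have t1 : `|t| < 1 by near: t; apply: dnbhs0_lt.
    have te : `|t| < eps / (M + 1) by near: t; apply: dnbhs0_lt; rewrite divr_gt0// ltr_wpDl.
    rewrite /= f0 subr0 addr0 [t *: 1]mulr1 normrZ normfV ltr_pdivrMl//.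
    apply: le_lt_trans (flM _ (le_trans (ler_norm _) (ltW t1))) _.
    rewrite -real_normK ?num_real// expr2 mulrA [ltRHS]mulrC ltr_pM2r//.
    rewrite ltr_pdivlMr in te; last by rewrite ltr_wpDl.
    by apply: le_lt_trans te; rewrite mulrC ler_wpM2l// lerDl.
  have fd0 : flat ('X^2 * (P - P^`())) 0 = 0 by rewrite /flat ltxx.
  by rewrite fd0; apply: DeriveDef; [exact: cvgP q0|exact: cvg_lim q0].
Unshelve. all: by end_near. Qed.

Lemma Cn_flat n (P : {poly R}) : Cn (fun _ : unit => 1 : R) n (flat P).
Proof.
elim: n P => [|n IH] P; split => //; last first.
  move=> _; exists (flat ('X^2 * (P - P^`()))); split => // x.
  exact: is_derive_flat.
all: move=> x; apply/differentiable_continuous/derivable1_diffP.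
all: by have [] := is_derive_flat P x.
Qed.

End iterated_derivatives.

Section plateau.
Context {R : realType}.
Local Notation C1 := (Cn (fun _ : unit => 1 : R)).

(** A smooth step from 0 on the left of 0 to 1 on the right of 1. *)
Definition step (x : R) : R := flat 1 x * (flat 1 x + flat 1 (1 - x))^-1.

(** A smooth bump equal to 1 on [[0, 1]] and vanishing off [[-1, 2]]. *)
Definition plateau (x : R) : R := step (x + 1) * step (2 - x).

Lemma flat1_ge0 x : 0 <= flat (1 : {poly R}) x.
Proof. by rewrite /flat; case: ifP => // _; rewrite hornerE mul1r expR_ge0. Qed.

Lemma flat1_gt0 x : 0 < x -> 0 < flat (1 : {poly R}) x.
Proof. by rewrite /flat => ->; rewrite hornerE mul1r expR_gt0. Qed.

Lemma step_denom_gt0 (x : R) : 0 < flat 1 x + flat 1 (1 - x).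
Proof.
have [x0|x0] := ltP 0 x.
  by rewrite ltr_pwDl ?flat1_gt0 ?flat1_ge0.
by rewrite ltr_wpDl ?flat1_ge0// flat1_gt0//; lra.
Qed.

Lemma step_ge0 x : 0 <= step x.
Proof. by rewrite divr_ge0 ?flat1_ge0// ltW// step_denom_gt0. Qed.

Lemma step_le1 x : step x <= 1.
Proof. by rewrite ler_pdivrMr ?step_denom_gt0// mul1r lerDl flat1_ge0. Qed.

Lemma step0 x : x <= 0 -> step x = 0.
Proof. by move=> x0; rewrite /step {1}/flat ltNge x0 mul0r. Qed.

Lemma step1 x : 1 <= x -> step x = 1.
Proof.
move=> x1; rewrite /step; have := step_denom_gt0 x.
have -> : flat 1 (1 - x) = 0 by rewrite /flat ifF//; lra.
by rewrite addr0 => ?; rewrite divff// gt_eqF.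
Qed.

Lemma Cn_step n : C1 n step.
Proof.
have C1x : C1 n (flat 1 \o (fun x => 1 - x) : R -> R).
  apply: (@Cn_comp_affine _ _ _ _ _ _ _ (fun=> -1)); last exact: Cn_flat.
    by move=> x; apply: cvgB; [exact: cvg_cst|exact: cvg_id].
  by move=> _ t x; rewrite [t *: _]mulr1; ring.
apply: CnM; first exact: Cn_flat.
apply: CnV; first by move=> x; rewrite gt_eqF// step_denom_gt0.
by apply: CnD => //; exact: Cn_flat.
Qed.

Lemma Cn_plateau n : C1 n plateau.
Proof.
have C1l : C1 n (step \o (fun x => x + 1) : R -> R).
  apply: (@Cn_comp_affine _ _ _ _ _ _ _ (fun=> 1)); last exact: Cn_step.
    by move=> x; apply: cvgD; [exact: cvg_id|exact: cvg_cst].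
  by move=> _ t x; rewrite [t *: _]mulr1; ring.
have C1r : C1 n (step \o (fun x => 2 - x) : R -> R).
  apply: (@Cn_comp_affine _ _ _ _ _ _ _ (fun=> -1)); last exact: Cn_step.
    by move=> x; apply: cvgB; [exact: cvg_cst|exact: cvg_id].
  by move=> _ t x; rewrite [t *: _]mulr1; ring.
exact: CnM.
Qed.

Lemma plateau01 x : 0 <= plateau x <= 1.
Proof.
rewrite mulr_ge0 ?step_ge0//= -[1]mulr1.
by rewrite ler_pM ?step_ge0 ?step_le1.
Qed.

Lemma plateau1 x : 0 <= x <= 1 -> plateau x = 1.
Proof. by move=> x01; rewrite /plateau !step1 ?mulr1//; lra. Qed.

Lemma plateau0l x : x <= -1 -> plateau x = 0.
Proof. by move=> x1; rewrite /plateau step0 ?mul0r//; lra. Qed.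

Lemma plateau0r x : 2 <= x -> plateau x = 0.
Proof. by move=> x1; rewrite /plateau [X in _ * X]step0 ?mulr0//; lra. Qed.

(** Clamping the argument to [[-1, 2]], where the derivative is bounded, does not
    change the value of the plateau. *)
Lemma plateau_lipschitz : exists2 L : R, 0 <= L &
  forall x y, `|plateau x - plateau y| <= L * `|x - y|.
Proof.
have [cp dp] := Cn_plateau 1; have [g [pg [cg _]]] := dp tt.
have ab : -1 <= 2 :> R by lra.
have cng : {within `[-1, 2], continuous (Num.norm \o g)}.
  by apply: continuous_subspaceT => x; apply: continuous_comp; [exact: cg|exact: norm_continuous].
have [c _ gc] := EVT_max ab cng.
exists `|g c| => // x y.
pose cl (z : R) := Num.max (-1) (Num.min 2 z).
have pcl z : plateau z = plateau (cl z).
  rewrite /cl; have [z2|z2] := leP 2 z.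
    by rewrite max_r// !plateau0r.
  have [z1|z1] := leP z (-1); last by [].
  by rewrite !plateau0l.
have clI z : cl z \in `[-1, 2].
  by rewrite in_itv/= /cl le_max lexx ge_max ab ge_min lexx.
have cll a b : a <= b -> cl a <= cl b /\ cl b - cl a <= b - a.
  have max2 : Num.max (-1) 2 = 2 :> R by rewrite max_r.
  rewrite /cl => ab'; have [a2|a2] := leP 2 a.
    by have [b2|b2] := leP 2 b; rewrite ?max2; split; lra.
  have [b2|b2] := leP 2 b; first by rewrite max2; have [?|?] := leP (-1) a; split; lra.
  by have [?|?] := leP (-1) a; have [?|?] := leP (-1) b; split; lra.
wlog xy : x y / x <= y => [H|].
  have [/H//|/ltW/H] := leP x y.
  by rewrite distrC [`|y - x|]distrC.
rewrite pcl (pcl y) distrC [`|x - y|]distrC.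
have [clxy clxy'] := cll _ _ xy.
have [|d dI ->] := MVT_segment clxy (fun z _ => pg z).
  by apply: continuous_subspaceT => z; exact: cp.
rewrite normrM; apply: ler_pM => //.
  apply: gc; rewrite in_itv/=; move: dI; rewrite in_itv/= => /andP[d1 d2].
  have := clI x; have := clI y; rewrite !in_itv/= => /andP[? ?] /andP[? ?].
  by apply/andP; split; lra.
by rewrite !ger0_norm ?subr_ge0.
Qed.

End plateau.

(** * Smooth cutoffs of a bounded open set *)

Section smooth_functions.
Context {R : realType} {N : nat}.

Definition basis_rV (i : 'I_N) : 'rV[R]_N := delta_mx 0 i.

Lemma iter_partial_rcons (s : seq 'I_N) i (f : 'rV[R]_N -> R) :
  iter_partial (rcons s i) f = iter_partial s ('D_(basis_rV i) f).
Proof. by elim: s => //= j s ->. Qed.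

Lemma Cn_smooth (f : 'rV[R]_N -> R) : (forall n, Cn basis_rV n f) -> smooth f.
Proof.
move=> Cf s; elim/last_ind: s f Cf => [|s i IH] f Cf.
  have [cf df] := Cf 1%N; split => // i x.
  by have [g [/(_ x)[]]] := df i.
rewrite iter_partial_rcons; apply: IH => n.
have [_ /(_ i)[g [fg gn]]] := Cf n.+1.
rewrite (_ : 'D_(basis_rV i) f = g)//.
by apply/funext => x; have [] := fg x.
Qed.

Lemma continuous_measurable_rV (f : 'rV[R]_N -> R) :
  continuous f -> measurable_fun setT f.
Proof.
move=> cf; apply: measurable_fun_open_lt => r.
by apply: (@open_comp _ _ f [set t : R | t < r]) => //; exact: open_lt.
Qed.

End smooth_functions.

(** Telescoping: replace the factors one at a time. *)
Lemma dist_prod_le (R : realDomainType) (J : Type) (s : seq J) (P : pred J)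
    (a b : J -> R) :
  (forall j, 0 <= a j <= 1) -> (forall j, 0 <= b j <= 1) ->
  `|\prod_(j <- s | P j) a j - \prod_(j <- s | P j) b j| <=
  \sum_(j <- s | P j) `|a j - b j|.
Proof.
move=> a01 b01.
elim: s => [|j s IH]; first by rewrite !big_nil subrr normr0.
rewrite !big_cons; case: ifP => // _.
set p := \prod_(j <- s | P j) a j; set q := \prod_(j <- s | P j) b j.
have /andP[aj0 aj1] := a01 j; have /andP[bj0 bj1] := b01 j.
have p01 : 0 <= p <= 1.
  apply/andP; split; first by apply: prodr_ge0 => i _; have /andP[] := a01 i.
  by apply: prodr_ile1 => i _; exact: a01.
rewrite (_ : _ - _ = (a j - b j) * p + b j * (p - q)); last by ring.
apply: le_trans (ler_normD _ _) _; apply: lerD.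
  by rewrite normrM ler_piMr// ger0_norm; case/andP: p01.
apply: le_trans IH; rewrite normrM ger0_norm// ler_piMl//.
Qed.

Section cutoff.
Context {R : realType} {N : nat}.
Variables (D : set 'rV[R]_N) (M h : R).
Hypotheses (D_le : forall x, D x -> `|x| <= M) (h0 : 0 < h).

(** Enough nodes per axis, from the corner [-M] with mesh [h], for the cells to
    cover the cube of radius [M], both end points included. *)
Definition lattice_size : nat := (Num.truncn (2 * M / h)).+1.

Local Notation index := {ffun 'I_N -> 'I_lattice_size}.

(** Position relative to the node [k] of a lattice of mesh [h] whose origin is
    the corner [-M], in units of [h]. *)
Definition lattice_coord (k : index) (i : 'I_N) (x : 'rV[R]_N) : R :=
  (x 0 i + M) / h - (k i)%:R.

Definition lattice_bump (k : index) (x : 'rV[R]_N) : R :=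
  \prod_(i < N) plateau (lattice_coord k i x).

(** A closed set containing the support of [lattice_bump k]. *)
Definition lattice_box (k : index) : set 'rV[R]_N :=
  [set x | forall i, -1 <= lattice_coord k i x <= 2].

Definition lattice_cell (x : 'rV[R]_N) : index :=
  [ffun i => inord (Num.truncn ((x 0 i + M) / h))].

Lemma lattice_cellP (x : 'rV[R]_N) i : `|x| <= M ->
  0 <= lattice_coord (lattice_cell x) i x < 1.
Proof.
move=> xM; have := le_trans (norm_coord_le x i) xM.
rewrite ler_norml => /andP[xi1 xi2].
have u0 : 0 <= (x 0 i + M) / h by rewrite divr_ge0 ?(ltW h0)//; lra.
have uM : (x 0 i + M) / h <= 2 * M / h by rewrite ler_pM2r ?invr_gt0//; lra.
rewrite /lattice_coord ffunE inordK; last first.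
  by rewrite ltnS; apply: le_truncn.
by rewrite subr_ge0 truncn_le u0/= ltrBlDl natr1 truncnS_gt.
Qed.

Lemma lattice_coord_continuous k i : continuous (lattice_coord k i).
Proof.
rewrite /lattice_coord => x; apply: (cvgB (F := nbhs x)); last exact: cvg_cst.
apply: (cvgM (F := nbhs x)); last exact: cvg_cst.
apply: (cvgD (F := nbhs x)); last exact: cvg_cst.
exact: coord_continuous.
Qed.

(** One minus the product, over the lattice nodes whose box lies in [D], of the
    complementary bumps: it equals 1 where at least one bump does. *)
Definition cutoff (x : 'rV[R]_N) : R :=
  1 - \prod_(k : index | `[< lattice_box k `<=` D >]) (1 - lattice_bump k x).

Lemma lattice_bump01 k x : 0 <= lattice_bump k x <= 1.
Proof.
apply/andP; split.
  by apply: prodr_ge0 => i _; have /andP[] := plateau01 (lattice_coord k i x).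
by apply: prodr_ile1 => i _; exact: plateau01.
Qed.

Lemma lattice_bump_neq0 k x i : lattice_bump k x != 0 ->
  -1 < lattice_coord k i x < 2.
Proof.
move=> /prodf_neq0 /(_ i isT) pl.
rewrite !ltNge; apply/andP; split; apply: contra pl => t.
  by rewrite plateau0l.
by rewrite plateau0r.
Qed.

Lemma cutoff01 x : 0 <= cutoff x <= 1.
Proof.
have b01 k : 0 <= 1 - lattice_bump k x <= 1.
  by have /andP[? ?] := lattice_bump01 k x; apply/andP; split; lra.
rewrite /cutoff subr_ge0 lerBlDr lerDl; apply/andP; split.
  by apply: prodr_ile1 => k _; exact: b01.
by apply: prodr_ge0 => k _; have /andP[] := b01 k.
Qed.

(** The box of the cell containing [x] is within distance [2 h] of [x], and the
    bump of this cell is 1 at [x]. *)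
Lemma cutoff1 x : D x -> cube x (2 * h) `<=` D -> cutoff x = 1.
Proof.
move=> Dx xD; have xM := D_le Dx; set k := lattice_cell x.
have kD : lattice_box k `<=` D.
  move=> y yk; apply: xD; apply/norm_rV_leP => [|i]; first by rewrite mulr_ge0// ltW.
  have /andP[x0 x1] := lattice_cellP i xM; have /andP[y1 y2] := yk i.
  have -> : (y - x) 0 i = (lattice_coord k i y - lattice_coord k i x) * h.
    by rewrite rV_subE /lattice_coord; field; rewrite gt_eqF.
  rewrite normrM (gtr0_norm h0) ler_pM2r// ler_norml.
  by apply/andP; split; lra.
rewrite /cutoff (bigD1 k)/=; last exact/asboolP.
rewrite [lattice_bump k x]big1 ?subrr ?mul0r ?subr0// => i _.
by rewrite plateau1//; have /andP[-> /ltW] := lattice_cellP i xM.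
Qed.

Lemma cutoff_neq0 x : cutoff x != 0 ->
  exists2 k, lattice_box k `<=` D & lattice_box k x.
Proof.
move=> fx; apply: contrapT => nk; move/eqP: fx; apply.
rewrite /cutoff big1 ?subrr// => k /asboolP kD.
suff -> : lattice_bump k x = 0 by rewrite subr0.
apply/eqP; apply: contrapT => /negP b0; apply: nk; exists k => // i.
by have /andP[/ltW -> /ltW ->] := lattice_bump_neq0 i b0.
Qed.

Lemma Cn_cutoff n : Cn basis_rV n cutoff.
Proof.
apply: CnD; first exact: Cn_cst.
apply/CnN/Cn_prod => k; apply: CnD; first exact: Cn_cst.
apply/CnN/Cn_prod => i.
apply: (@Cn_comp_affine _ _ _ _ _ plateau (lattice_coord k i)
  (fun j => (j == i)%:R / h)); last exact: Cn_plateau.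
  exact: lattice_coord_continuous.
move=> j t x; rewrite /lattice_coord !mxE eqxx/= eq_sym.
by field; rewrite gt_eqF.
Qed.

Lemma closed_lattice_box k : closed (lattice_box k).
Proof.
rewrite (_ : lattice_box k =
  \bigcap_i (lattice_coord k i @^-1` `[-1, 2]%classic)); last first.
  apply/seteqP; split => x /= xk i; first by move=> _ /=; rewrite in_itv/=.
  by have := xk i I; rewrite /= in_itv.
apply: closed_bigI => i _; apply: preimage_closed; last exact: interval_closed.
by move=> x _; exact: lattice_coord_continuous.
Qed.

Lemma cutoff_Cc_infty : Cc_infty D cutoff.
Proof.
pose B := \bigcup_(k in [set k : index | lattice_box k `<=` D]) lattice_box k.
have clB : closed B.
  apply: closed_bigcup => [|k _]; last exact: closed_lattice_box.
  exact: finite_finset.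
have BD : B `<=` D by move=> x [k /= kD]; exact: kD.
have sB : closure [set x | cutoff x != 0] `<=` B.
  move/closure_id : clB => ->; apply: closureS => x /= /cutoff_neq0[k kD kx].
  by exists k.
split; [by apply: Cn_smooth => n; exact: Cn_cutoff| |exact: subset_trans BD].
apply: bounded_closed_compact; last exact: closed_closure.
exists M; split; first exact: num_real.
by move=> r Mr x /sB/BD/D_le xM; exact: le_trans (ltW Mr).
Qed.

(** Along each axis only the nodes [a - 1], [a] and [a + 1] can carry a bump that
    does not vanish at [x], where [a] is the position of [x] in
    units of [h], rounded down and truncated at 0. *)
Lemma card_lattice_bump (x : 'rV[R]_N) :
  (#|[set k : index | lattice_bump k x != 0%R]%SET| <= 3 ^ N)%N.
Proof.
pose a (i : 'I_N) := Num.truncn ((x 0 i + M) / h).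
(* The shift by one keeps the truncated subtraction exact. *)
pose g (k : index) : {ffun 'I_N -> 'I_3} := [ffun i => inord (k i + 1 - a i)].
have aP k i : lattice_bump k x != 0 -> (a i <= k i + 1 <= a i + 2)%N.
  move=> /(lattice_bump_neq0 i)/andP[]; rewrite /lattice_coord => k1 k2.
  have k0 : (0 : R) <= (k i)%:R by [].
  have u1 : -1 < (x 0 i + M) / h by lra.
  have ua : (x 0 i + M) / h < (a i).+1%:R by exact: truncnS_gt.
  apply/andP; split.
    have [u0|u0] := leP 0 ((x 0 i + M) / h); last by rewrite /a truncn_floor ifN// -ltNge.
    have au : (a i)%:R <= (x 0 i + M) / h by rewrite truncn_le.
    by rewrite addn1 -ltnS -(ltr_nat R) -addn2 natrD; lra.
  by rewrite addn2 addn1 ltnS -ltnS -(ltr_nat R) -natr1; lra.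
rewrite -(card_ord 3) -[X in (_ ^ X)%N](card_ord N) -card_ffun.
rewrite -(card_in_imset (f := g)); first exact: max_card.
move=> k l; rewrite !inE => kx lx /ffunP kl; apply/ffunP => i.
have := kl i; rewrite !ffunE => /(congr1 val) /=.
have /andP[k1 k2] := aP _ i kx; have /andP[l1 l2] := aP _ i lx.
rewrite !inordK; [|by rewrite ltnS leq_subLR..] => E; apply/val_inj => /=.
apply/eqP; rewrite -(eqn_add2r 1) -(subnK k1) E subnK//.
Qed.

(** A sum over all nodes would degenerate with the mesh, but at most [2 * 3^N]
    bumps differ at two given points; the constant depends on [N] and the
    plateau alone. *)
Lemma cutoff_lipschitz (L : R) (x y : 'rV[R]_N) :
  (forall u v : R, `|plateau u - plateau v| <= L * `|u - v|) ->
  `|cutoff x - cutoff y| <= (2 * 3 ^ N * N)%:R * L * (`|x - y| / h).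
Proof.
move=> plL.
have L0 : 0 <= L.
  by have := plL 1 0; rewrite subr0 normr1 mulr1; exact: le_trans.
have b01 z k : 0 <= 1 - lattice_bump k z <= 1.
  by have /andP[? ?] := lattice_bump01 k z; apply/andP; split; lra.
have d0 : 0 <= `|x - y| / h by rewrite divr_ge0// ltW.
have bxy k : `|lattice_bump k x - lattice_bump k y| <= N%:R * (L * (`|x - y| / h)).
  apply: le_trans.
    by apply: dist_prod_le => i; exact: plateau01.
  rewrite mulr_natl -[X in _ *+ X]card_ord -sumr_const; apply: ler_sum => i _.
  apply: le_trans (plL _ _) _; rewrite ler_wpM2l//.
  rewrite (_ : _ - _ = (x - y) 0 i / h); last first.
    by rewrite rV_subE /lattice_coord; field; rewrite gt_eqF.
  by rewrite normrM normfV (gtr0_norm h0) ler_pM2r ?invr_gt0// norm_coord_le.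
rewrite /cutoff opprB addrC addrA subrK distrC.
apply: le_trans (dist_prod_le _ _ (b01 x) (b01 y)) _.
pose K := [set k : index | lattice_bump k x != 0] :|: [set k : index | lattice_bump k y != 0].
apply: (@le_trans _ _ (\sum_(k in K) `|lattice_bump k x - lattice_bump k y|)).
  rewrite [leRHS]big_mkcond/= big_mkcond/=; apply: ler_sum => k _.
  have -> : 1 - lattice_bump k x - (1 - lattice_bump k y) =
    lattice_bump k y - lattice_bump k x by ring.
  rewrite distrC; case: ifP => _; last by case: ifP.
  case: ifPn => //; rewrite !inE negb_or !negbK => /andP[/eqP -> /eqP ->].
  by rewrite subrr normr0.
apply: (@le_trans _ _ (\sum_(k in K) N%:R * (L * (`|x - y| / h)))).
  exact: ler_sum.
rewrite sumr_const -[leLHS]mulr_natl mulrA -natrM -[leRHS]mulrA.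
apply: ler_wpM2r; first exact: mulr_ge0.
rewrite ler_nat leq_mul2r; apply/orP; right.
apply: leq_trans (leq_card_setU _ _) _; rewrite mul2n -addnn.
by apply: leq_add; exact: card_lattice_bump.
Qed.

End cutoff.

(** * Volume of a strip along a Lipschitz boundary *)

Section exit_point.
Context {R : realType} {N : nat}.
Implicit Types (D : set 'rV[R]_N) (x y : 'rV[R]_N).

(** The exit time is the infimum of the times spent outside [D]; it is attained
    because the complement of [D] is closed. *)
Lemma exit_point D x y : open D -> D x -> ~ D y ->
  exists t : R, [/\ 0 < t, t <= 1, ~ D (x + t *: (y - x)) &
    forall u, 0 <= u -> u < t -> D (x + u *: (y - x))].
Proof.
move=> oD Dx nDy; pose E := [set t : R | 0 <= t /\ ~ D (x + t *: (y - x))].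
have E1 : E 1 by split => //; rewrite scale1r addrC subrK.
have lbE : has_lbound E by exists 0 => t [].
have t0 : 0 <= inf E by apply: lb_le_inf; [exists 1|move=> t []].
have ltE u : 0 <= u -> u < inf E -> D (x + u *: (y - x)).
  move=> u0 uE; apply: contrapT => nDu.
  by move: uE; rewrite ltNge => /negP; apply; apply: ge_inf.
have nDt : ~ D (x + inf E *: (y - x)).
  move=> Dt; have : nbhs (x + inf E *: (y - x)) D by exact: open_nbhs_nbhs.
  rewrite -nbhs_ballE => -[e /= e0 eD].
  have d0 : 0 < e / (`|y - x| + 1) by rewrite divr_gt0// ltr_wpDl.
  have [t Et tE] := inf_adherent d0 (conj (ex_intro _ 1 E1) lbE).
  have [_ []] := Et; apply: eD; rewrite -ball_normE /=.
  rewrite opprD addrACA subrr add0r -scalerBl normrZ distrC ger0_norm; last first.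
    by rewrite subr_ge0 ge_inf.
  rewrite -ltrBlDl ltr_pdivlMr ?ltr_wpDl// in tE; apply: le_lt_trans tE.
  by rewrite ler_wpM2l ?lerDl// subr_ge0 ge_inf.
exists (inf E); split => //; last exact: ge_inf.
rewrite lt_neqAle t0 andbT; apply/eqP => E0; apply: nDt.
by rewrite -E0 scale0r addr0.
Qed.

Lemma boundary_near D x y : open D -> D x -> ~ D y ->
  exists2 z, boundary D z & `|x - z| <= `|x - y|.
Proof.
move=> oD Dx nDy; have [t [t0 t1 nDt Dt]] := exit_point oD Dx nDy.
exists (x + t *: (y - x)); last first.
  rewrite opprD addNKr normrN normrZ distrC gtr0_norm// ler_piMl//.
split; last by move/interior_subset.
move=> U; rewrite -nbhs_ballE => -[e /= e0 eU].
pose d := Num.min t (e / (`|y - x| + 1)).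
have d0 : 0 < d by rewrite lt_min t0 divr_gt0// ltr_wpDl.
have dt : d <= t by rewrite ge_min lexx.
exists (x + (t - d / 2) *: (y - x)); split; first by apply: Dt; lra.
apply: eU; rewrite -ball_normE /=.
rewrite opprD addrACA subrr add0r -scalerBl normrZ opprB addrC subrK gtr0_norm; last by lra.
have : d <= e / (`|y - x| + 1) by rewrite ge_min lexx orbT.
rewrite ler_pdivlMr ?ltr_wpDl//; apply: lt_le_trans.
apply: (@le_lt_trans _ _ (d / 2 * (`|y - x| + 1))).
  by rewrite ler_wpM2l ?lerDl//; lra.
by rewrite ltr_pM2r ?ltr_wpDl//; lra.
Qed.

Lemma lipschitz_continuous_rV (g : 'rV[R]_N -> R) (C : R) : 0 <= C ->
  (forall x y, `|g x - g y| <= C * `|x - y|) -> continuous g.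
Proof.
move=> C0 gC x; apply/(@cvgrPdist_lt _ _ _ (nbhs x)) => e e0; near=> y.
apply: le_lt_trans (gC _ _) _.
have : `|x - y| < e / (C + 1).
  near: y; have : nbhs x (ball x (e / (C + 1))).
    by apply: nbhsx_ballx; rewrite divr_gt0// ltr_wpDl.
  by rewrite -ball_normE.
rewrite ltr_pdivlMr ?ltr_wpDl//; apply: le_lt_trans.
by rewrite mulrC ler_wpM2l// lerDl.
Unshelve. all: by end_near. Qed.

Lemma bounded_norm_le D : bounded_set D ->
  exists2 M : R, 0 < M & forall x, D x -> `|x| <= M.
Proof.
move=> [M0 [_ MD]]; exists (Num.max M0 0 + 1).
  by rewrite ltr_wpDl// le_max lexx orbT.
by move=> x Dx; apply: MD Dx; rewrite ltr_pwDr// le_max lexx.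
Qed.

Lemma closure_norm_le D (M : R) : (forall x, D x -> `|x| <= M) ->
  forall x, closure D x -> `|x| <= M.
Proof.
move=> DM x Dx; apply/ler_addgt0Pr => e e0.
have [y [Dy]] := Dx _ (nbhsx_ballx x e e0); rewrite -ball_normE /= => xy.
rewrite -[x](subrK y) addrC; apply: le_trans (ler_normD _ _) _.
by rewrite lerD ?DM// ltW.
Qed.

End exit_point.

Lemma measure_finite_cover d (T : measurableType d) (R : realType)
    (mu : {measure set T -> \bar R}) (K : finType) (F : K -> set T) (B : set T) :
  measurable B -> (forall k, measurable (F k)) -> B `<=` \bigcup_k F k ->
  (mu B <= \sum_(k : K) mu (F k))%E.
Proof.
move=> mB mF BF.
have le_big (s : seq K) :
    (mu (\big[setU/set0]_(k <- s) F k) <= \sum_(k <- s) mu (F k))%E.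
  elim: s => [|k s IH]; first by rewrite !big_nil measure0.
  rewrite !big_cons; apply: le_trans (leeD2l _ IH).
  by apply: measureU2 => //; exact: bigsetU_measurable.
apply: le_trans (le_big (index_enum K)); apply: le_measure; rewrite ?inE//.
  exact: bigsetU_measurable.
move=> x /BF[k _ Fx]; rewrite -bigcup_seq; exists k => //=.
exact: mem_index_enum.
Qed.

Section lipschitz_strip.
Context {R : realType}.

Lemma card_lattice_index_le n (M h : R) : 0 <= M -> 0 < h -> h <= 1 ->
  #|{ffun 'I_n -> 'I_(lattice_size M h)}|%:R <= ((2 * M + 1) / h) ^+ n.
Proof.
move=> M0 h0 h1; rewrite card_ffun !card_ord natrX lerXn2r ?nnegrE//.
  by rewrite divr_ge0 ?(ltW h0)//; lra.
rewrite /lattice_size -natr1 [leRHS]mulrDl lerD//.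
  by rewrite truncn_le divr_ge0 ?mulr_ge0// ltW.
by rewrite mul1r invf_ge1.
Qed.

Lemma lattice_cell_dist n (M h : R) (x y : 'rV[R]_n) : 0 < h ->
  `|x| <= M -> `|y| <= M -> lattice_cell M h x = lattice_cell M h y ->
  `|x - y| <= h.
Proof.
move=> h0 xM yM xy; apply/norm_rV_leP => [|i]; first exact: ltW.
have /andP[x0 x1] := lattice_cellP h0 i xM.
have /andP[y0 y1] := lattice_cellP h0 i yM.
have -> : (x - y) 0 i = (lattice_coord (lattice_cell M h x) i x -
    lattice_coord (lattice_cell M h y) i y) * h.
  by rewrite xy rV_subE /lattice_coord; field; rewrite gt_eqF.
rewrite normrM (gtr0_norm h0) ler_piMl ?(ltW h0)// ler_norml.
by apply/andP; split; lra.
Qed.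

Variables (n : nat) (D : set 'rV[R]_n.+1).

Lemma enorm_col'_le (x : 'rV[R]_n.+1) : enorm (col' ord_max x) <= n%:R * `|x|.
Proof.
apply: le_trans (enorm_le _) _; rewrite ler_wpM2l//; apply/norm_rV_leP => // i.
by rewrite mxE norm_coord_le.
Qed.

Lemma col'B (x y : 'rV[R]_n.+1) :
  col' ord_max (x - y) = col' ord_max x - col' ord_max y.
Proof. by apply/rowP => i; rewrite !mxE. Qed.

Lemma norm_col'_le (x : 'rV[R]_n.+1) : `|col' ord_max x| <= `|x|.
Proof. by apply/norm_rV_leP => // i; rewrite mxE norm_coord_le. Qed.

(** Near a boundary point [z0] the boundary is, up to the isometry [L], the
    graph of [phi]; dropping the last coordinate is then injective on it with
    a Lipschitz inverse. *)
Lemma boundary_chart (r0 Lip : R) (z0 : 'rV[R]_n.+1)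
    (L : {linear 'rV[R]_n.+1 -> 'rV[R]_n.+1}) (phi : 'rV[R]_n -> R) :
  open D -> 0 < r0 -> 0 <= Lip ->
  (forall x, enorm (L x) = enorm x) ->
  (forall u v, `|phi u - phi v| <= Lip * enorm (u - v)) ->
  (L @` D) `&` eball (L z0) r0 =
    [set x | phi (col' ord_max x) < x 0 ord_max] `&` eball (L z0) r0 ->
  forall z, boundary D z -> enorm (z - z0) < r0 ->
  phi (col' ord_max (L z)) = L z 0 ord_max.
Proof.
move=> oD r00 Lip0 isoL lphi LD z [Dz nDz] zz0.
have LB w : enorm (w - z0) = enorm (L w - L z0) by rewrite -linearB isoL.
have normL w w' : `|L w - L w'| <= n.+1%:R * `|w - w'|.
  by rewrite -linearB; apply: le_trans (norm_le_enorm _) _; rewrite isoL enorm_le.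
pose g w := L w 0 ord_max - phi (col' ord_max (L w)).
have gC w w' : `|g w - g w'| <= (1 + Lip * n%:R) * n.+1%:R * `|w - w'|.
  have -> : g w - g w' = (L w - L w') 0 ord_max -
      (phi (col' ord_max (L w)) - phi (col' ord_max (L w'))).
    by rewrite rV_subE /g; ring.
  apply: le_trans (ler_normB _ _) _.
  rewrite -mulrA mulrDl mul1r; apply: lerD.
    exact: le_trans (norm_coord_le _ _) (normL _ _).
  apply: le_trans (lphi _ _) _; rewrite -!mulrA ler_wpM2l//.
  rewrite -col'B; apply: le_trans (enorm_col'_le _) _.
  by rewrite ler_wpM2l.
have cg : continuous g.
  by apply: lipschitz_continuous_rV gC; rewrite mulr_ge0// addr_ge0// mulr_ge0.
suff : g z = 0 by move/eqP; rewrite subr_eq0 => /eqP.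
apply/eqP; rewrite eq_le; apply/andP; split; rewrite leNgt; apply/negP => gz.
  have : (L @` D `&` eball (L z0) r0) (L z).
    rewrite LD; split; last by rewrite /eball/= -LB.
    by rewrite /= -subr_gt0.
  move=> [[w Dw Lwz] _].
  have wz : w = z.
    apply/eqP; rewrite -subr_eq0 -[_ == 0]negbK -enorm_gt0 -isoL linearB Lwz.
    by rewrite subrr enorm0 ltxx.
  by apply: nDz; rewrite -wz; apply: open_nbhs_nbhs.
have : nbhs z ([set w | g w < 0] `&` eball z0 r0).
  apply: open_nbhs_nbhs; split => //; apply: openI; last exact: open_eball.
  by apply: (@open_comp _ _ g [set t : R | t < 0]) => //; exact: open_lt.
move=> /Dz[w [Dw [gw wz0]]].
have : (L @` D `&` eball (L z0) r0) (L w).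
  by split; [exists w|rewrite /eball/= -LB].
by rewrite LD => -[/= + _]; rewrite -subr_gt0 ltNge (ltW gw).
Qed.

(** The boundary of a bounded Lipschitz domain is covered by finitely many
    charts, recorded here by a label [j], in each of which it is the Lipschitz
    image of a bounded subset of R^n. *)
Lemma boundary_atlas (M : R) : 0 < M -> (forall x, D x -> `|x| <= M) ->
  lipschitz_domain D ->
  exists (J : finType) (lab : 'rV[R]_n.+1 -> J) (p : J -> 'rV[R]_n.+1 -> 'rV[R]_n)
    (M' C : R), [/\ 0 < M', 0 <= C,
    forall j z, boundary D z -> lab z = j -> `|p j z| <= M' &
    forall j z z', boundary D z -> boundary D z' -> lab z = j -> lab z' = j ->
      `|z - z'| <= C * `|p j z - p j z'| ].
Proof.
move=> M0 DM [[_ oD _] [r0 [Lip [r00 chart]]]].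
have bM z : boundary D z -> `|z| <= M by move=> [/(closure_norm_le DM)].
(* Two points in the same cell of mesh [eta] are at Euclidean distance at most
   [n.+1 * eta < r0]. *)
pose eta := r0 / n.+2%:R.
have eta0 : 0 < eta by rewrite divr_gt0.
pose J := {ffun 'I_n.+1 -> 'I_(lattice_size M eta)} : finType.
pose lab := lattice_cell M eta : 'rV[R]_n.+1 -> J.
pose C := n.+1%:R * (1 + `|Lip| * n%:R).
have C0 : 0 <= C by rewrite mulr_ge0// addr_ge0// mulr_ge0.
have M'0 : 0 < n.+1%:R * M by rewrite mulr_gt0.
have /choice[p pP] (j : J) : exists p : 'rV[R]_n.+1 -> 'rV[R]_n,
    (forall z, boundary D z -> lab z = j -> `|p z| <= n.+1%:R * M) /\
    (forall z z', boundary D z -> boundary D z' -> lab z = j -> lab z' = j ->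
      `|z - z'| <= C * `|p z - p z'|).
  have [[z0 [bz0 lz0]]|no] := pselect (exists z0, boundary D z0 /\ lab z0 = j); last first.
    exists (fun=> 0); split; first by move=> z bz lz; exfalso; apply: no; exists z.
    by move=> z z' bz _ lz; exfalso; apply: no; exists z.
  have [L [phi [isoL lphi LD]]] := chart _ bz0.
  have lphi' u v : `|phi u - phi v| <= `|Lip| * enorm (u - v).
    by apply: le_trans (lphi u v) _; rewrite ler_wpM2r ?enorm_ge0// ler_norm.
  have graph z : boundary D z -> lab z = j -> phi (col' ord_max (L z)) = L z 0 ord_max.
    move=> bz lz; apply: (boundary_chart oD r00 _ isoL lphi' LD) => //.
    apply: le_lt_trans (enorm_le _) _.
    apply: (@le_lt_trans _ _ (n.+1%:R * eta)).
      rewrite ler_wpM2l//; apply: (@lattice_cell_dist _ M) => //; try exact: bM.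
      by rewrite -/(lab z) lz -lz0.
    by rewrite /eta mulrCA gtr_pMr// ltr_pdivrMr// mul1r ltr_nat.
  exists (fun z => col' ord_max (L z)); split.
    move=> z bz _; apply: le_trans (norm_col'_le _) _.
    apply: le_trans (norm_le_enorm _) _; rewrite isoL.
    by apply: le_trans (enorm_le _) _; rewrite ler_wpM2l// bM.
  move=> z z' bz bz' lz lz'.
  apply: le_trans (norm_le_enorm _) _; rewrite -isoL linearB.
  apply: le_trans (enorm_le _) _; rewrite -mulrA ler_wpM2l//.
  set d := col' ord_max (L z) - col' ord_max (L z').
  have CD0 : 0 <= (1 + `|Lip| * n%:R) * `|d|.
    by rewrite mulr_ge0// addr_ge0// mulr_ge0.
  apply/norm_rV_leP => // i; case: (unliftP ord_max i) => [k|] ->.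
    have -> : (L z - L z') 0 (lift ord_max k) = d 0 k by rewrite !mxE.
    apply: le_trans (norm_coord_le _ _) _.
    by rewrite ler_peMl// lerDl mulr_ge0.
  rewrite rV_subE -!graph//; apply: le_trans (lphi' _ _) _.
  rewrite mulrDl mul1r; apply: ler_wpDl => //.
  by rewrite -mulrA ler_wpM2l// enorm_le.
by exists J, lab, p, (n.+1%:R * M), C; split => // j; have [] := pP j.
Qed.

(** The boundary is covered by [O(h^-n)] cubes of side [O(h)], since every chart
    is the Lipschitz image of a bounded subset of R^n. *)
Lemma lipschitz_strip_le : bounded_set D -> lipschitz_domain D ->
  exists2 C : R, 0 < C & forall (h : R) (B : set 'rV[R]_n.+1), 0 < h -> h <= 1 ->
    measurable B ->
    (forall x, B x -> exists2 z, boundary D z & `|x - z| <= 2 * h) ->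
    (@lebesgue_rV R n.+1 B <= (C * h)%:E)%E.
Proof.
move=> /bounded_norm_le[M M0 DM] /(boundary_atlas M0 DM).
move=> [J [lab [p [M' [C [M'0 C0 pM' pC]]]]]].
pose S := 2 * (C + 2) : R.
have S0 : 0 < S by rewrite mulr_gt0// ltr_wpDl.
exists ((#|J|%:R * (2 * M' + 1) ^+ n + 1) * S ^+ n.+1).
  by rewrite mulr_gt0 ?exprn_gt0// ltr_wpDl// mulr_ge0// exprn_ge0//; lra.
move=> h B h0 h1 mB BD.
pose K := (J * {ffun 'I_n -> 'I_(lattice_size M' h)})%type : finType.
pose code z : K := (lab z, lattice_cell M' h (p (lab z) z)).
(* One boundary point for each code in use, an arbitrary point for the others. *)
have /choice[rep repP] (k : K) : exists z0, forall z, boundary D z -> code z = k ->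
    boundary D z0 /\ code z0 = k.
  have [[z0 ?]|no] := pselect (exists z0, boundary D z0 /\ code z0 = k).
    by exists z0.
  by exists 0 => z bz cz; exfalso; apply: no; exists z.
have BK : B `<=` \bigcup_k cube (rep k) ((C + 2) * h).
  move=> x /BD[z bz xz]; exists (code z) => //.
  have [bz0 cz0] := repP _ _ bz erefl; set z0 := rep (code z) in bz0 cz0 *.
  have [labz0 cell0] : lab z0 = lab z /\
      lattice_cell M' h (p (lab z0) z0) = lattice_cell M' h (p (lab z) z).
    by case: cz0.
  rewrite /cube/= -(subrK z x) -addrA; apply: le_trans (ler_normD _ _) _.
  rewrite mulrDl [leRHS]addrC; apply: lerD => //.
  apply: le_trans (pC (lab z) _ _ bz bz0 erefl labz0) _; rewrite ler_wpM2l//.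
  apply: (@lattice_cell_dist _ M') => //; try exact: pM'.
  by rewrite -cell0 labz0.
apply: le_trans (measure_finite_cover _ mB _ BK) _.
  by move=> k; exact: measurable_cube.
rewrite (eq_bigr (fun=> ((2 * ((C + 2) * h)) ^+ n.+1)%:E)); last first.
  move=> k _; apply: lebesgue_rV_cube.
  by rewrite mulr_ge0 ?addr_ge0// ltW.
rewrite sumEFin lee_fin sumr_const -[leLHS]mulr_natl card_prod natrM.
rewrite [2 * _]mulrA -/S exprMn.
have := card_lattice_index_le n (ltW M'0) h0 h1.
rewrite exprMn exprVn => cardle.
rewrite [leRHS](_ : _ = (#|J|%:R * (2 * M' + 1) ^+ n * h + h) * S ^+ n.+1); last by ring.
rewrite [leLHS](_ : _ = (#|J|%:R *
  (#|{ffun 'I_n -> 'I_(lattice_size M' h)}|%:R * h ^+ n.+1)) * S ^+ n.+1); last by ring.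
rewrite ler_pM2r ?exprn_gt0//; apply: ler_wpDr; first exact: ltW.
rewrite -mulrA ler_wpM2l// exprS mulrCA [leRHS]mulrC ler_wpM2l ?(ltW h0)//.
by rewrite -ler_pdivlMr ?exprn_gt0.
Qed.

End lipschitz_strip.

(** * Upper bound of the modular *)

Section modular_bound.
Context {R : realType} {n : nat}.
Local Notation leb := (@lebesgue_rV R n.+1).
Variables (s : R) (A : R -> R) (D : set 'rV[R]_n.+1).
Hypotheses (s0 : 0 < s) (s1 : s < 1) (AN : N_function A) (oD : open D).

(** The kernel dominating the integrand of the modular for functions with
    values in [[0, 1]] and slope at most [1 / a]: the Lipschitz bound rules
    below the scale [a] and the trivial bound above it. *)
Definition modular_kernel (a r : R) : R :=
  (if a^-1 * r `^ (1 - s) <= a `^ (- s)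
   then A (a^-1 * r `^ (1 - s)) / r ^+ n.+1 else 0) +
  (if 1 * r `^ (- s) <= a `^ (- s)
   then A (1 * r `^ (- s)) / r ^+ n.+1 else 0).

Lemma modular_kernel_branch_ge0 (l q t r : R) : 0 <= l -> 0 <= r ->
  0 <= (if l * r `^ q <= t then A (l * r `^ q) / r ^+ n.+1 else 0).
Proof.
move=> l0 r0; case: ifP => // _.
by rewrite divr_ge0 ?exprn_ge0// N_function_ge0// mulr_ge0// powR_ge0.
Qed.

Lemma modular_kernel_ge0 (a r : R) : 0 < a -> 0 <= r -> 0 <= modular_kernel a r.
Proof.
move=> a0 r0; apply: addr_ge0; apply: modular_kernel_branch_ge0 => //.
by rewrite invr_ge0 ltW.
Qed.

Lemma measurable_kernel_branch d (T : measurableType d) (rho : T -> R) (l q t : R) :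
  0 <= l -> measurable_fun setT rho ->
  measurable_fun setT (fun p => if l * rho p `^ q <= t
    then A (l * rho p `^ q) / rho p ^+ n.+1 else 0).
Proof.
move=> l0 mr.
have mq : measurable_fun setT (fun p => l * rho p `^ q).
  by apply: measurable_funM => //; exact: (measurableT_comp (@measurable_powR R q)).
apply: measurable_fun_ifT => //; first exact: measurable_fun_ler.
apply: measurable_funM.
  by apply: N_function_measurable_comp => // p; rewrite mulr_ge0// powR_ge0.
by apply: (measurableT_comp (@measurable_invr R)); exact: measurable_funX.
Qed.

Lemma modular_le_kernel (a r v : R) : 0 < a -> 0 < r -> 0 <= v ->
  v <= 1 -> v <= r / a -> A (v / r `^ s) / r ^+ n.+1 <= modular_kernel a r.
Proof.
move=> a0 r0 v0 v1 va.
have vs : 0 <= v / r `^ s by rewrite divr_ge0// powR_ge0.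
have r1s : r / r `^ s = r `^ (1 - s) by rewrite powRB ?gt_eqF// powRr1// ltW.
have [ra|ar] := leP r a.
  (* Below the scale [a] the first branch of the kernel is enough, above it the
     second one is. *)
  apply: ler_wpDr; first exact: (modular_kernel_branch_ge0 _ _ ler01 (ltW r0)).
  rewrite ifT; last first.
    rewrite ler_pdivrMl// -{1}[a]powRr1 ?(ltW a0)// -powRD; last first.
      by rewrite (gt_eqF a0) implybT.
    by apply: ge0_ler_powR => //; rewrite ?nnegrE ?(ltW a0) ?(ltW r0)// subr_ge0 ltW.
  rewrite ler_pM2r ?invr_gt0 ?exprn_gt0//; apply: N_function_le => //.
  by rewrite -r1s mulrA ler_wpM2r ?invr_ge0 ?powR_ge0// mulrC.
apply: ler_wpDl; first by apply: modular_kernel_branch_ge0; rewrite ?invr_ge0 ltW.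
rewrite ifT; last first.
  rewrite mul1r !powRN lef_pV2 ?posrE ?powR_gt0//.
  by apply: ge0_ler_powR; rewrite ?nnegrE ?(ltW a0) ?(ltW r0) ?(ltW s0) ?(ltW ar).
rewrite ler_pM2r ?invr_gt0 ?exprn_gt0//; apply: N_function_le => //.
by rewrite powRN ler_wpM2r// invr_ge0 powR_ge0.
Qed.

Local Open Scope ereal_scope.

Definition kernel_const : R := (shell_const n.+1 (1 - s) + shell_const n.+1 (- s))%R.

Lemma kernel_const_ge0 : (0 <= kernel_const)%R.
Proof. by apply: addr_ge0; exact: shell_const_ge0. Qed.

Lemma integral_kernel_le (a : R) (x : 'rV[R]_n.+1) : (0 < a)%R ->
  \int[leb]_y (modular_kernel a (enorm (x - y)))%:E <=
  kernel_const%:E *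
    \int[lebesgue_measure]_(w in `]0%R, (2 * a `^ (- s))%R]) (A w / w)%:E.
Proof.
move=> a0; have ia0 : (0 <= a^-1)%R by rewrite invr_ge0 ltW.
under eq_integral do rewrite EFinD.
have mr := measurable_enorm_subr x.
rewrite ge0_integralD//; last 4 first.
- by move=> y _; rewrite lee_fin modular_kernel_branch_ge0 ?enorm_ge0.
- by apply/measurable_EFinP; exact: measurable_kernel_branch.
- by move=> y _; rewrite lee_fin modular_kernel_branch_ge0 ?enorm_ge0.
- by apply/measurable_EFinP; exact: measurable_kernel_branch.
have as0 : (0 < a `^ (- s))%R by exact: powR_gt0.
rewrite /kernel_const EFinD ge0_muleDl ?lee_fin ?shell_const_ge0//.
apply: leeD; apply: integral_N_function_powR_le => //.
- by rewrite subr_eq0 gt_eqF.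
- by rewrite invr_gt0.
- by rewrite oppr_eq0 gt_eqF.
Qed.

Lemma measurable_neq1 (f : 'rV[R]_n.+1 -> R) : continuous f ->
  measurable (D `&` [set x | f x != 1%R]).
Proof.
move=> /continuous_measurable_rV mf.
apply: measurableI; first exact: open_rV_measurable.
rewrite (_ : [set x | _] = f @^-1` [set~ 1%R]); last first.
  by apply/seteqP; split => x /eqP.
by rewrite -[X in measurable X]setTI; apply: mf => //; exact: measurableC.
Qed.

(** Only pairs with one point in [[set x in D | f x != 1]] contribute to the
    modular of [f], hence the factor given by the volume of this set. *)
Lemma modular_le (f : 'rV[R]_n.+1 -> R) (a : R) : (0 < a)%R ->
  continuous f -> (forall x, 0 <= f x <= 1)%R ->
  (forall x y, `|f x - f y| <= enorm (x - y) / a)%R ->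
  modular s A D f <=
  2%:E * leb (D `&` [set x | f x != 1%R]) * (kernel_const%:E *
    \int[lebesgue_measure]_(w in `]0%R, (2 * a `^ (- s))%R]) (A w / w)%:E).
Proof.
move=> a0 cf f01 fa; set B := D `&` _; set I := kernel_const%:E * _.
have mf := continuous_measurable_rV cf.
have mD : measurable D by exact: open_rV_measurable.
have mB : measurable B by exact: measurable_neq1.
have ia0 : (0 <= a^-1)%R by rewrite invr_ge0 ltW.
have I0 : 0 <= I.
  apply: mule_ge0; first by rewrite lee_fin kernel_const_ge0.
  apply: integral_ge0 => w /=; rewrite in_itv/= => /andP[w0 _].
  by rewrite lee_fin divr_ge0 ?N_function_ge0// ltW.
pose rho (p : 'rV[R]_n.+1 * 'rV[R]_n.+1) := enorm (p.1 - p.2).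
have mrho : measurable_fun setT rho by exact: measurable_enorm_sub.
have rho0 p : (0 <= rho p)%R by exact: enorm_ge0.
pose G p : \bar R := (modular_kernel a (rho p))%:E.
have G0 p : 0 <= G p by rewrite lee_fin modular_kernel_ge0.
have mG : measurable_fun setT G.
  apply/measurable_EFinP; apply: measurable_funD; exact: measurable_kernel_branch.
pose F1 (p : 'rV[R]_n.+1 * 'rV[R]_n.+1) := (\1_B p.1 : R)%:E * G p.
pose F2 (p : 'rV[R]_n.+1 * 'rV[R]_n.+1) := (\1_B p.2 : R)%:E * G p.
have mind : measurable_fun setT (\1_B : 'rV[R]_n.+1 -> R) by exact: measurable_indic.
have mF1 : measurable_fun setT F1.
  apply: emeasurable_funM => //; apply/measurable_EFinP.
  exact: (measurableT_comp mind measurable_fst).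
have mF2 : measurable_fun setT F2.
  apply: emeasurable_funM => //; apply/measurable_EFinP.
  exact: (measurableT_comp mind measurable_snd).
have F10 p : 0 <= F1 p by rewrite mule_ge0// lee_fin.
have F20 p : 0 <= F2 p by rewrite mule_ge0// lee_fin.
apply: (@le_trans _ _ (\int[leb \x leb]_p (F1 p + F2 p))).
  rewrite /modular integral_mkcond; apply: ge0_le_integral => //.
  - move=> p _; apply: erestrict_ge0 => q _.
    rewrite /= lee_fin divr_ge0 ?exprn_ge0 ?enorm_ge0//.
    by rewrite N_function_ge0// divr_ge0// powR_ge0.
  - apply/(measurable_restrictT _ _).1; first exact: measurableX.
    apply/measurable_EFinP/measurable_funTS; apply: measurable_funM.
      apply: N_function_measurable_comp => //; last first.
        by move=> p; rewrite divr_ge0// powR_ge0.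
      apply: measurable_funM.
        apply: measurableT_comp => //; apply: measurable_funB.
          exact: (measurableT_comp mf measurable_fst).
        exact: (measurableT_comp mf measurable_snd).
      apply: (measurableT_comp (@measurable_invr R)).
      exact: (measurableT_comp (@measurable_powR R s)).
    by apply: (measurableT_comp (@measurable_invr R)); exact: measurable_funX.
  - exact: emeasurable_funD.
  move=> [x y] _; rewrite patchE; case: ifPn => [/set_mem[/= Dx Dy]|_]; last first.
    exact: adde_ge0.
  have [fxy|fxy] := eqVneq (f x) (f y).
    by rewrite fxy subrr normr0 mul0r N_function0// mul0r adde_ge0.
  have GF : (A (`|f x - f y| / enorm (x - y) `^ s) / enorm (x - y) ^+ n.+1)%:E <= G (x, y).
    rewrite lee_fin; apply: modular_le_kernel => //.
      by rewrite enorm_gt0 subr_eq0; apply: contra fxy => /eqP ->.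
    have /andP[? ?] := f01 x; have /andP[? ?] := f01 y.
    by rewrite ler_norml; apply/andP; split; lra.
  apply: le_trans GF _.
  have [fx1|fx1] := eqVneq (f x) 1%R.
    have By : y \in B by apply/mem_set; split => //=; rewrite -fx1 eq_sym.
    by rewrite /F2 /= indicE By mul1e leeDr.
  have Bx : x \in B by apply/mem_set.
  by rewrite /F1 /= indicE Bx mul1e leeDl.
rewrite ge0_integralD//.
have half H : measurable_fun setT H -> (forall x, 0 <= H x <= I) ->
    \int[leb]_x ((\1_B x : R)%:E * H x) <= leb B * I.
  move=> mH HI; apply: (@le_trans _ _ (\int[leb]_x ((\1_B x : R)%:E * I))).
    apply: ge0_le_integral => //.
    - by move=> x _; rewrite mule_ge0 ?lee_fin//; have /andP[] := HI x.
    - by apply: emeasurable_funM => //; exact/measurable_EFinP.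
    - by apply: emeasurable_funM => //; exact/measurable_EFinP.
    - by move=> x _; apply: lee_wpmul2l; rewrite ?lee_fin//; have /andP[] := HI x.
  rewrite ge0_integralZr//; last by apply/measurable_EFinP.
  by rewrite integral_indic// setIT.
have Hle x : 0 <= \int[leb]_y G (x, y) <= I.
  by apply/andP; split; [exact: integral_ge0|exact: integral_kernel_le].
have Gsym x y : G (x, y) = G (y, x) by rewrite /G /rho /= enorm_sub.
have E1 x : \int[leb]_y F1 (x, y) = (\1_B x : R)%:E * \int[leb]_y G (x, y).
  rewrite -ge0_integralZl ?lee_fin//.
  exact: (measurableT_comp mG (pair1_measurable x)).
have E2 y : \int[leb]_x F2 (x, y) = (\1_B y : R)%:E * \int[leb]_x G (y, x).
  transitivity (\int[leb]_x ((\1_B y : R)%:E * G (y, x))).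
    by apply: eq_integral => x _; rewrite /F2 Gsym.
  apply: ge0_integralZl => //.
  exact: (measurableT_comp mG (pair1_measurable y)).
have mGF := measurable_fun_fubini_tonelli_F (m2 := leb) G mG G0.
rewrite -muleA mule_natl mule2n; apply: leeD.
  by rewrite fubini_tonelli1// (eq_integral _ _ (fun x _ => E1 x)); exact: half.
by rewrite fubini_tonelli2// (eq_integral _ _ (fun x _ => E2 x)); exact: half.
Qed.

End modular_bound.

(** * Distance to the complement and lower bounds of integrals *)

Section distance_to_complement.
Context {R : realType} {n : nat}.
Variables (D : set 'rV[R]_n.+1) (M : R).
Hypotheses (oD : open D) (M0 : 0 < M) (DM : forall x, D x -> `|x| <= M).

Lemma far_notin (x : 'rV[R]_n.+1) i : M < `|x 0 i| -> ~ D x.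
Proof. by move=> Mx /DM; rewrite leNgt (lt_le_trans Mx)// norm_coord_le. Qed.

Lemma exists_notin : exists y, ~ D y.
Proof.
exists (const_mx (M + 1)); apply: (@far_notin _ ord0).
by rewrite mxE gtr0_norm ?addr_gt0// ltrDl.
Qed.

Lemma has_lbound_dist (x : 'rV[R]_n.+1) :
  has_lbound [set enorm (x - y) | y in ~` D].
Proof. by exists 0 => _ [y _ <-]; exact: enorm_ge0. Qed.

Lemma dist_compl_le (x y : 'rV[R]_n.+1) : ~ D y -> dist_compl D x <= enorm (x - y).
Proof. by move=> nDy; apply: ge_inf; [exact: has_lbound_dist|exists y]. Qed.

Lemma dist_compl_gt0 x : D x -> 0 < dist_compl D x.
Proof.
move=> Dx; have : nbhs x D by exact: open_nbhs_nbhs.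
rewrite -nbhs_ballE => -[e /= e0 eD]; apply: lt_le_trans e0 _.
have [y nDy] := exists_notin.
apply: lb_le_inf; first by exists (enorm (x - y)), y.
move=> _ [z nDz <-]; rewrite leNgt; apply/negP => xz; apply: nDz; apply: eD.
by rewrite -ball_normE /=; apply: le_lt_trans xz; exact: norm_le_enorm.
Qed.

(** The sublevel sets are unions of balls centred off [D]. *)
Lemma measurable_dist_compl : measurable_fun setT (dist_compl D).
Proof.
apply: measurable_fun_open_lt => r.
rewrite (_ : [set x | _] = \bigcup_(y in ~` D) eball y r).
  by apply: bigcup_open => y _; exact: open_eball.
apply/seteqP; split => x /=.
  move=> /inf_lt[]; last by move=> _ [y nDy <-] xyr; exists y.
  by have [y nDy] := exists_notin; exists (enorm (x - y)), y.
by move=> [y nDy]; apply: le_lt_trans; exact: dist_compl_le.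
Qed.

End distance_to_complement.

Section lower_bounds.
Context {R : realType}.
Local Open Scope ereal_scope.

Lemma ge0_integral_ge_cst d (T : measurableType d) (mu : {measure set T -> \bar R})
    (D Q : set T) (g : T -> \bar R) (c : \bar R) :
  measurable D -> measurable Q -> Q `<=` D -> measurable_fun D g ->
  (forall x, D x -> 0 <= g x) -> 0 <= c -> (forall x, Q x -> c <= g x) ->
  c * mu Q <= \int[mu]_(x in D) g x.
Proof.
move=> mD mQ QD mg g0 c0 cg; rewrite -integral_cst//.
apply: le_trans (@ge0_subset_integral _ _ _ mu _ _ mQ mD _ mg g0 QD).
by apply: ge0_le_integral => //; exact: measurable_funS mg.
Qed.

(** The reciprocal of the distance to [e] is not integrable to the left of
    [e]: each dyadic block contributes the same amount. *)
Lemma integral_inv_dist_pinfty (U : R -> \bar R) (c e r : R) :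
  (0 < c)%R -> (0 < r)%R -> measurable_fun setT U -> (forall t, 0 <= U t) ->
  (forall t, (e - r < t)%R -> (t < e)%R -> (c / (e - t))%:E <= U t) ->
  \int[lebesgue_measure]_t U t = +oo.
Proof.
move=> c0 r0 mU U0 cU.
pose b k := (e - r / 2 ^+ k)%R.
have b2 k : (b k.+1 - b k = r / 2 ^+ k.+1)%R.
  by rewrite /b exprS; field; rewrite expf_neq0.
have r2 k : (0 < r / 2 ^+ k)%R by rewrite divr_gt0// exprn_gt0.
have bS k : (b k < b k.+1)%R by rewrite -subr_gt0 b2.
have b0 k : (b 0%N <= b k)%R.
  by elim: k => // k /le_trans; apply; exact: ltW.
have mUD (D : set R) : measurable_fun D U by exact: measurable_funTS.
have J m : (m%:R * (c / 2))%:E <= \int[lebesgue_measure]_(t in `]b 0%N, b m]) U t.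
  elim: m => [|m IH]; first by rewrite mul0r integral_ge0.
  have -> : `]b 0%N, b m.+1]%classic = `]b 0%N, b m] `|` `]b m, b m.+1].
    by rewrite -itv_bndbnd_setU//= bnd_simp ?b0// ltW.
  rewrite ge0_integral_setU//; last first.
    rewrite disj_set2E; apply/eqP; rewrite -subset0 => t /= [].
    by rewrite !in_itv/= => /andP[_ tb] /andP[]; rewrite ltNge tb.
    exact: mUD.
  rewrite -natr1 mulrDl mul1r EFinD; apply: leeD => //.
  have -> : (c / 2)%:E = (c / (r / 2 ^+ m))%:E * lebesgue_measure `]b m, b m.+1].
    rewrite lebesgue_measure_itv/= lte_fin bS -EFinB b2 -EFinM exprS.
    by congr EFin; field; rewrite expf_neq0// gt_eqF.
  apply: ge0_integral_ge_cst => //; first exact: mUD.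
    by rewrite lee_fin divr_ge0// ltW.
  move=> t; rewrite /= in_itv/= => /andP[bt tb].
  have te : (t < e)%R by apply: le_lt_trans tb _; rewrite /b ltrBlDr ltrDl.
  apply: le_trans (cU _ _ te); last first.
    by apply: le_lt_trans bt; apply: le_trans (b0 m); rewrite /b expr0 divr1.
  rewrite lee_fin ler_pM2l// lef_pV2 ?posrE ?subr_gt0//.
  by rewrite /b in bt; lra.
have le_U m : (m%:R * (c / 2))%:E <= \int[lebesgue_measure]_t U t.
  by apply: le_trans (J m) _; apply: ge0_subset_integral.
apply/eqP; rewrite -leye_eq leNgt; apply/negP => Ufin.
have U0' : 0 <= \int[lebesgue_measure]_t U t by exact: integral_ge0.
have /fineK UE : \int[lebesgue_measure]_t U t \is a fin_num by rewrite ge0_fin_numE.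
pose m := (Num.truncn (fine (\int[lebesgue_measure]_t U t) / (c / 2))).+1.
have := le_U m; rewrite -UE lee_fin leNgt => /negP; apply.
by rewrite -ltr_pdivrMr ?divr_gt0// truncnS_gt.
Qed.

End lower_bounds.

(** * Divergence of the Hardy denominator *)

Section denominators.
Context {R : realType} {n : nat}.
Local Notation leb := (@lebesgue_rV R n.+1).
Variables (s : R) (A : R -> R) (D : set 'rV[R]_n.+1) (M : R).
Hypotheses (s0 : 0 < s) (AN : N_function A) (oD : open D) (M0 : 0 < M).
Hypothesis (DM : forall x, D x -> `|x| <= M).

Lemma open_cube_sub x : D x -> exists2 r : R, 0 < r & cube x r `<=` D.
Proof.
move=> Dx; have : nbhs x D by exact: open_nbhs_nbhs.
rewrite -nbhs_ballE => -[e /= e0 eD]; exists (e / 2); first by rewrite divr_gt0.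
move=> y xy; apply: eD; rewrite -ball_normE /= distrC.
by apply: le_lt_trans xy _; lra.
Qed.

Lemma cube_trans (x y z : 'rV[R]_n.+1) (a b c : R) : a + b <= c ->
  cube x a y -> cube y b z -> cube x c z.
Proof.
move=> abc xy yz; apply: le_trans abc; rewrite -(subrK y z) -addrA addrC.
by apply: le_trans (ler_normD _ _) _; exact: lerD.
Qed.

Lemma cutoff_cube1 x0 (r h : R) : 0 < h -> cube x0 r `<=` D -> 4 * h <= r ->
  forall x, cube x0 (r / 2) x -> cutoff D M h x = 1.
Proof.
move=> h0 rD hr x xx0; apply: cutoff1 => //.
  by apply: rD; apply: le_trans xx0 _; lra.
by move=> y xy; apply: rD; apply: cube_trans xx0 xy; lra.
Qed.

Lemma cutoff_near1 x : D x -> \forall k \near \oo, cutoff D M k.+1%:R^-1 x = 1.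
Proof.
move=> Dx; have [r r0 rD] := open_cube_sub Dx.
have r4 : 0 < r / 4 by rewrite divr_gt0.
near=> k; apply: (@cutoff_cube1 x r) => //.
  by rewrite mulrC -ler_pdivlMr// ltW//; near: k; exact: (near_infty_natSinv_lt (PosNum r4)).
by rewrite /cube/= subrr normr0 divr_ge0// ltW.
Unshelve. all: by end_near. Qed.

Local Open Scope ereal_scope.

Lemma measurable_hardy_density (f : 'rV[R]_n.+1 -> R) : measurable_fun setT f ->
  measurable_fun setT (fun x => (A (`|f x| / dist_compl D x `^ s))%:E).
Proof.
move=> mf; apply/measurable_EFinP; apply: N_function_measurable_comp => //.
  apply: measurable_funM; first exact: measurableT_comp.
  apply: (measurableT_comp (@measurable_invr R)).
  apply: (measurableT_comp (@measurable_powR R s)).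
  exact: (measurable_dist_compl M0 DM).
by move=> x; rewrite divr_ge0// powR_ge0.
Qed.

Lemma hardy_density_ge0 (f : 'rV[R]_n.+1 -> R) x :
  0 <= (A (`|f x| / dist_compl D x `^ s))%:E.
Proof. by rewrite lee_fin N_function_ge0// divr_ge0// powR_ge0. Qed.

Lemma modular_ge0 (f : 'rV[R]_n.+1 -> R) : 0 <= modular s A D f.
Proof.
apply: integral_ge0 => p _.
by rewrite lee_fin divr_ge0 ?exprn_ge0 ?enorm_ge0// N_function_ge0// divr_ge0// powR_ge0.
Qed.

(** On every line parallel to the first axis through a small cube, the density
    [A (1 / delta^s)] dominates the reciprocal of the distance to the exit
    point of the line, which is not integrable. *)
Lemma integral_hardy_density_pinfty (eps0 c : R) :
  D !=set0 -> (0 < eps0)%R -> (0 < c)%R ->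
  (forall e, 0 < e -> e < eps0 -> c / e <= A (e `^ (- s)))%R ->
  \int[leb]_(x in D) (A (`|1| / dist_compl D x `^ s))%:E = +oo.
Proof.
move=> [x0 Dx0] e0 c0 cA; have [r r0 rD] := open_cube_sub Dx0.
have mD : measurable D by exact: open_rV_measurable.
pose H := (fun x => (A (`|1| / dist_compl D x `^ s))%:E) \_ D.
have H0 x : 0 <= H x by apply: erestrict_ge0 => y _; exact: (hardy_density_ge0 (cst 1%R)).
have mH : measurable_fun setT H.
  apply/(measurable_restrictT _ _).1 => //; apply: measurable_funTS.
  exact: (measurable_hardy_density (f := cst 1%R)).
rewrite integral_mkcond -/H ge0_integral_lebesgue_rVS//.
pose Q := cube (uncons_rV x0).2 r.
have line x' : Q x' -> \int[lebesgue_measure]_t H (cons_rV (t, x')) = +oo.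
  move=> Qx'; pose a : R := (x0 0 ord0)%R.
  have Da : D (cons_rV (a, x')).
    by apply: rD; apply/(cube_cons_rV _ _ _ (ltW r0)); rewrite /a subrr normr0 ltW.
  pose b := (`|a| + M + 1)%R.
  have nDb : ~ D (cons_rV ((a + b)%R, x')).
    apply: (far_notin DM (i := ord0)); rewrite cons_rV0.
    have := ler_norm a; have := ler_norm (- a); rewrite normrN.
    have := ler_norm (a + b); rewrite /b; lra.
  have lineE (u : R) : (cons_rV (a, x') +
      u *: (cons_rV ((a + b)%R, x') - cons_rV (a, x')) = cons_rV ((a + u * b)%R, x'))%R.
    apply/rowP => i; rewrite mxE [in X in (_ + X)%R]mxE rV_subE.
    case: (unliftP ord0 i) => [j|] ->; first by rewrite !cons_rVS subrr mulr0 addr0.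
    by rewrite !cons_rV0; ring.
  have [t [t0 t1 nDt Dt]] := exit_point oD Da nDb.
  have b0 : (0 < b)%R by rewrite ltr_wpDl// addr_ge0// ltW.
  pose e := (a + t * b)%R; rewrite lineE -/e in nDt.
  have in_D (v : R) : (a <= v)%R -> (v < e)%R -> D (cons_rV (v, x')).
    move=> av ve; rewrite (_ : v = (a + (v - a) / b * b)%R); last first.
      by rewrite divfK ?gt_eqF// addrC subrK.
    rewrite -lineE; apply: Dt; first by rewrite divr_ge0 ?subr_ge0// ltW.
    by rewrite ltr_pdivrMr// ltrBlDl.
  have ae : (a < e)%R by rewrite ltrDl mulr_gt0.
  apply: (@integral_inv_dist_pinfty _ _ c e (Num.min eps0 (e - a))%R c0).
  - by rewrite lt_min e0 subr_gt0.
  - apply: (measurableT_comp mH).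
    exact: (measurableT_comp (@measurable_cons_rV R n) (pair2_measurable x')).
  - by move=> v; exact: H0.
  move=> v; rewrite ltrBlDr -ltrBlDl lt_min => /andP[ve0 ve1] ve.
  have Dv : D (cons_rV (v, x')) by apply: in_D => //; lra.
  rewrite /H patchE mem_set// normr1 div1r lee_fin -powRN.
  have d0 := dist_compl_gt0 oD M0 DM Dv.
  have de : (dist_compl D (cons_rV (v, x')) <= e - v)%R.
    apply: le_trans (dist_compl_le _ nDt) _.
    rewrite /enorm big_ord_recl big1 => [|i _]; last first.
      by rewrite rV_subE !cons_rVS subrr expr0n.
    rewrite addr0 rV_subE !cons_rV0 sqrtr_sqr distrC ger0_norm// subr_ge0.
    exact: ltW.
  apply: le_trans (cA _ d0 (le_lt_trans de ve0)).
  by rewrite ler_pM2l// lef_pV2 ?posrE// subr_gt0.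
have mQ : measurable Q by exact: measurable_cube.
apply/eqP; rewrite -leye_eq.
apply: le_trans (@ge0_integral_ge_cst _ _ _ (@lebesgue_rV R n) setT Q _ +oo
  measurableT mQ _ _ _ _ _); rewrite ?leey//.
- rewrite [X in _ * X]lebesgue_rV_cube ?(ltW r0)// gt0_mulye// lte_fin exprn_gt0//.
  by rewrite mulr_gt0.
- apply: (measurable_fun_fubini_tonelli_G (m1 := lebesgue_measure) (H \o @cons_rV R n)).
    exact: (measurableT_comp mH (@measurable_cons_rV R n)).
  by move=> p; exact: H0.
- by move=> x _; apply: integral_ge0.
- by move=> x /line ->.
Qed.

(** Fatou's lemma: on [D] the cutoffs are eventually equal to 1, and the limit
    density has infinite integral. *)
Lemma hardy_denominator_near (eps0 c K : R) :
  D !=set0 -> (0 < eps0)%R -> (0 < c)%R ->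
  (forall e, 0 < e -> e < eps0 -> c / e <= A (e `^ (- s)))%R ->
  \forall k \near \oo, K%:E <=
    \int[leb]_(x in D) (A (`|cutoff D M k.+1%:R^-1 x| / dist_compl D x `^ s))%:E.
Proof.
move=> D0 e0 c0 cA; have mD : measurable D by exact: open_rV_measurable.
pose F k x := (A (`|cutoff D M k.+1%:R^-1 x| / dist_compl D x `^ s))%:E.
have mF k : measurable_fun D (F k).
  apply: measurable_funTS; apply: measurable_hardy_density.
  apply: continuous_measurable_rV; apply: (Cn_continuous (n := 0)).
  by apply: Cn_cutoff; rewrite invr_gt0.
have F0 k x : D x -> 0 <= F k x by move=> _; exact: hardy_density_ge0.
have := @fatou _ _ _ (@lebesgue_rV R n.+1) D mD F mF F0.
rewrite (_ : \int[_]_(x in D) _ = +oo); last first.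
  rewrite -(integral_hardy_density_pinfty D0 e0 c0 cA).
  apply: eq_integral => x /set_mem Dx.
  have Fx : F^~ x @ \oo --> (A (`|1| / dist_compl D x `^ s))%:E.
    apply: cvg_near_cst; near=> k; rewrite /F.
    have -> // : cutoff D M k.+1%:R^-1 x = 1%R.
    by near: k; exact: cutoff_near1.
  by rewrite is_cvg_limn_einfE; [exact: cvg_lim Fx|exact: cvgP Fx].
set u := (fun k => \int[_]_(_ in D) F k _).
rewrite leye_eq => /eqP u_oo.
have : K%:E < ereal_sup (range (einfs u)).
  have /cvg_lim <- // := @cvg_einfs_sup R u.
  by rewrite -limn_einf_lim u_oo ltry.
move=> /ereal_sup_gt[_ [m _ <-] Km]; near=> k.
apply: le_trans (ltW Km) _; apply: ereal_inf_lbound => /=.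
by exists k => //=; near: k; exact: nbhs_infty_ge.
Unshelve. all: by end_near. Qed.

End denominators.

(** * Vanishing of the optimal constants *)

Lemma ereal_inf_quotient0 (R : realType) (T : Type) (S : set T) (m d : T -> \bar R) :
  (forall f, 0 <= m f)%E -> (forall f, 0 <= d f)%E ->
  (forall eta : R, 0 < eta -> exists f (a b : R),
     [/\ S f, (m f <= a%:E)%E, 0 < b, (b%:E <= d f)%E & a <= eta * b]) ->
  ereal_inf [set (m f / d f)%E | f in S] = 0%E.
Proof.
move=> m0 d0 small; apply/eqP; rewrite eq_le; apply/andP; split; last first.
  by apply: le_ereal_inf_tmp => _ [f _ <-]; rewrite mule_ge0// inve_ge0.
apply/lee_addgt0Pr => eta eta0; rewrite add0e.
have [f [a [b [Sf ma b0 bd ab]]]] := small _ eta0.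
apply: le_trans (ereal_inf_lbound _) _; first by exists f.
apply: (@le_trans _ _ (a%:E * b%:E^-1)%E).
  apply: lee_pmul => //; first by rewrite inve_ge0.
  rewrite lee_pV2//; rewrite inE/= ?d0//.
  by rewrite lee_fin ltW.
by rewrite inver gt_eqF// -EFinM lee_fin ler_pdivrMr.
Qed.

Section lipschitz_domain_asymptotics.
Context {R : realType} {n : nat}.
Variables (s : R) (A : R -> R) (D : set 'rV[R]_n.+1) (M : R).
Hypotheses (s0 : 0 < s) (s1 : s < 1) (AN : N_function A) (M0 : 0 < M).
Hypotheses (D_bounded : bounded_set D) (D_lipschitz : lipschitz_domain D).
Hypothesis (DM : forall x, D x -> `|x| <= M).

Let oD : open D. Proof. by have [[]] := D_lipschitz. Qed.
Let D0 : D !=set0. Proof. by have [[]] := D_lipschitz. Qed.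

Definition level_integral (e : R) : \bar R :=
  (e%:E * \int[lebesgue_measure]_(z in `]0%R, (e `^ (- s))%R]) (A z / z)%:E)%E.

(** The set where the cutoff of mesh [h] differs from 1 is a strip of volume
    [O(h)], and the kernel bound applies with scale [a] proportional to [h]. *)
Lemma modular_cutoff_le : exists (C kappa : R), [/\ 0 <= C, 0 < kappa &
  forall h, 0 < h -> h <= 1 ->
    (modular s A D (cutoff D M h) <= C%:E * level_integral (kappa * h))%E].
Proof.
have [L L0 plL] := @plateau_lipschitz R.
have [V V0 stripV] := lipschitz_strip_le D_bounded D_lipschitz.
(* The cutoff of mesh [h] is Lipschitz with constant [K / h]; adding 1 ensures
   that [K] is positive. *)
pose K : R := (2 * 3 ^ n.+1 * n.+1)%:R * L + 1.
have K0 : 0 < K by rewrite ltr_wpDl// mulr_ge0.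
pose kc : R := @kernel_const R n s.
have kc0 : 0 <= kc by exact: kernel_const_ge0.
(* With [a = h / K], this is the choice for which [(kappa h)^-s = 2 a^-s]. *)
pose kappa : R := 2 `^ (- s^-1) / K.
have kappa0 : 0 < kappa by rewrite divr_gt0// powR_gt0.
exists (2 * V * kc / kappa), kappa; split => //.
  apply: divr_ge0; last exact: ltW.
  by rewrite !mulr_ge0// ltW.
move=> h h0 h1; pose a := h / K; have a0 : 0 < a by rewrite divr_gt0.
have kh : kappa * h = 2 `^ (- s^-1) * a by rewrite /kappa /a; ring.
have khs : (kappa * h) `^ (- s) = 2 * a `^ (- s).
  rewrite kh powRM ?powR_ge0 ?(ltW a0)// -powRrM mulrNN mulVf ?gt_eqF// powRr1//.
have cf : continuous (cutoff D M h).
  by apply: (Cn_continuous (n := 0)); exact: Cn_cutoff.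
have fa x y : `|cutoff D M h x - cutoff D M h y| <= enorm (x - y) / a.
  apply: le_trans (cutoff_lipschitz D M h0 x y plL) _.
  rewrite /a invf_div mulrA [leRHS]mulrA ler_pM2r ?invr_gt0// [leRHS]mulrC.
  by apply: ler_pM => //; [exact: mulr_ge0|rewrite lerDl|exact: norm_le_enorm].
have := modular_le s0 s1 AN oD a0 cf (cutoff01 D M h) fa.
set B := D `&` _ => modB; apply: le_trans modB _.
have BV : (@lebesgue_rV R n.+1 B <= (V * h)%:E)%E.
  apply: stripV => //; first exact: measurable_neq1.
  move=> x [Dx /= fx].
  have [y [xy nDy]] : exists y, cube x (2 * h) y /\ ~ D y.
    apply: contrapT => no; move/eqP: fx; apply; apply: cutoff1 => // y xy.
    by apply: contrapT => nDy; apply: no; exists y.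
  have [z bz xz] := boundary_near oD Dx nDy.
  by exists z => //; apply: le_trans xz _; rewrite distrC.
rewrite /level_integral khs -/kc.
set I := (\int[_]_(_ in _) _)%E.
have I0 : (0 <= I)%E.
  apply: integral_ge0 => w /=; rewrite in_itv/= => /andP[w0 _].
  by rewrite lee_fin divr_ge0 ?N_function_ge0// ltW.
rewrite !muleA; apply: lee_wpmul2r => //.
apply: (@le_trans _ _ (2%:E * (V * h)%:E * kc%:E)%E).
  by apply: lee_wpmul2r; rewrite ?lee_fin//; apply: lee_wpmul2l.
rewrite -!EFinM lee_fin le_eqVlt; apply/orP; left; apply/eqP.
by field; rewrite gt_eqF.
Qed.

Variable (beta : R).
Hypothesis lim_beta : level_integral eps @[eps --> (0 : R)^'+] --> beta%:E.

(** The limit along [h = 1 / (k + 1)] of the previous bound. *)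
Lemma modular_cutoff_near : exists2 C : R, 0 <= C & forall b, beta < b ->
  \forall k \near \oo, (modular s A D (cutoff D M k.+1%:R^-1) <= (C * b)%:E)%E.
Proof.
have [C [kappa [C0 kappa0 modC]]] := modular_cutoff_le.
exists C => // b bb; have bbE : (beta%:E < b%:E)%E by rewrite lte_fin.
have [d /= d0 dP] := lim_beta (open_ereal_lt' bbE).
have dk0 : 0 < d / kappa by rewrite divr_gt0.
near=> k; have k0 : 0 < k.+1%:R^-1 :> R by rewrite invr_gt0.
have k1 : k.+1%:R^-1 <= 1 :> R by rewrite invf_le1// ler1n.
apply: (le_trans (modC _ k0 k1)).
rewrite EFinM; apply: lee_wpmul2l; first by rewrite lee_fin.
apply/ltW/dP => /=; last exact: mulr_gt0.
rewrite sub0r normrN gtr0_norm ?mulr_gt0// mulrC -ltr_pdivlMr//.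
by near: k; exact: (near_infty_natSinv_lt (PosNum dk0)).
Unshelve. all: by end_near. Qed.

(** As [A z / z] is nondecreasing, the primitive of [A z / z] is bounded by [A]
    itself, so a positive limit forces [A] to grow at least like a power. *)
Lemma N_function_growth : 0 < beta -> exists2 eps0 : R, 0 < eps0 &
  forall e, 0 < e -> e < eps0 -> beta / 2 / e <= A (e `^ (- s)).
Proof.
move=> beta0; have bbE : ((beta / 2)%:E < beta%:E)%E by rewrite lte_fin; lra.
have [d /= d0 dP] := lim_beta (open_ereal_gt' bbE).
exists d => // e e0 ed; rewrite ler_pdivrMr// [leRHS]mulrC -lee_fin.
have de : ball 0 d e by rewrite /ball/= sub0r normrN gtr0_norm.
apply: (le_trans (ltW (dP _ de e0))).
rewrite EFinM; apply: lee_wpmul2l; first by rewrite lee_fin ltW.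
by apply: integral_N_function_div_le => //; exact: powR_gt0.
Qed.

Lemma cutoff_admissible (x : 'rV[R]_n.+1) h : 0 < h ->
  cutoff D M h x = 1 -> Cc_infty D (cutoff D M h) /\ cutoff D M h <> (fun=> 0).
Proof.
move=> h0 fx1; split; first exact: cutoff_Cc_infty.
by move=> /(congr1 (fun f => f x)); rewrite fx1 => /eqP; rewrite oner_eq0.
Qed.

(** On a fixed cube inside [D] the cutoffs are eventually 1, and the distance to
    the complement is bounded above because [D] is bounded. *)
Lemma denominators_ge : exists2 c : R, 0 < c & \forall k \near \oo,
  (c%:E <= \int[@lebesgue_rV R n.+1]_(x in D)
      (A (`|cutoff D M k.+1%:R^-1 x| / dist_compl D x `^ s))%:E)%E /\
  (c%:E <= \int[@lebesgue_rV R n.+1]_(x in D) (A `|cutoff D M k.+1%:R^-1 x|)%:E)%E.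
Proof.
have [x0 Dx0] := D0; have [r r0 rD] := open_cube_sub oD Dx0.
have mD : measurable D by exact: open_rV_measurable.
pose Q := cube x0 (r / 2).
have r20 : 0 < r / 2 by rewrite divr_gt0.
have QD : Q `<=` D by move=> x Qx; apply: rD; apply: le_trans Qx _; lra.
have [y0 nDy0] := exists_notin M0 DM.
pose d : R := n.+1%:R * (M + `|y0|).
have d0 : 0 < d by rewrite mulr_gt0// ltr_pwDl.
have dle x : D x -> dist_compl D x <= d.
  move=> Dx; apply: le_trans (dist_compl_le x nDy0) _.
  apply: le_trans (enorm_le _) _; rewrite ler_wpM2l//.
  by apply: le_trans (ler_normB _ _) _; rewrite lerD// DM.
pose c1 := A (d `^ (- s)); pose c2 := A 1.
have Apos t : 0 < t -> 0 < A t by have [_ _ [_ +] _ _] := AN; apply.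
have c10 : 0 < c1 by apply: Apos; exact: powR_gt0.
have c20 : 0 < c2 by exact: Apos.
pose v := (2 * (r / 2)) ^+ n.+1.
have v0 : 0 < v by rewrite exprn_gt0// mulr_gt0.
exists (Num.min c1 c2 * v); first by rewrite mulr_gt0// lt_min c10.
have r4 : 0 < r / 4 by rewrite divr_gt0.
near=> k.
have : 4 * k.+1%:R^-1 <= r.
  by rewrite mulrC -ler_pdivlMr// ltW//; near: k; exact: (near_infty_natSinv_lt (PosNum r4)).
set h := k.+1%:R^-1 => hr; have h0 : 0 < h by rewrite invr_gt0.
have f1 x : Q x -> cutoff D M h x = 1 by exact: cutoff_cube1.
have mf : measurable_fun setT (cutoff D M h).
  apply: continuous_measurable_rV; apply: (Cn_continuous (n := 0)).
  exact: Cn_cutoff.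
have vE : @lebesgue_rV R n.+1 Q = v%:E by apply: lebesgue_rV_cube; exact: ltW.
have min0 : 0 <= Num.min c1 c2 by rewrite le_min !ltW.
rewrite EFinM -vE; split.
  apply: ge0_integral_ge_cst => //; first exact: measurable_cube.
  - by apply: measurable_funTS; exact: (measurable_hardy_density s AN M0 DM mf).
  - by move=> x _; exact: hardy_density_ge0.
  move=> x Qx; rewrite f1// normr1 div1r -powRN lee_fin ge_min; apply/orP; left.
  have dx0 := dist_compl_gt0 oD M0 DM (QD _ Qx).
  apply: N_function_le => //; first exact: powR_ge0.
  rewrite !powRN lef_pV2 ?posrE ?powR_gt0//.
  by apply: ge0_ler_powR; rewrite ?nnegrE ?(ltW s0) ?(ltW dx0) ?(ltW d0)// dle//; exact: QD.
apply: ge0_integral_ge_cst => //; first exact: measurable_cube.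
- apply: measurable_funTS; apply/measurable_EFinP.
  by apply: N_function_measurable_comp => //; exact: measurableT_comp.
- by move=> x _; rewrite lee_fin N_function_ge0.
by move=> x Qx; rewrite f1// normr1 lee_fin ge_min lexx orbT.
Unshelve. all: by end_near. Qed.

Lemma poincare_density_ge0 (f : 'rV[R]_n.+1 -> R) x : (0 <= (A `|f x|)%:E)%E.
Proof. by rewrite lee_fin N_function_ge0. Qed.

(** If [beta = 0] the modulars tend to 0 while the denominators stay away from 0;
    if [beta > 0] the modulars stay bounded while the Hardy denominators tend to
    infinity. *)
Lemma sharp_constants_eq0 : 0 <= beta ->
  hardy_constant s A D = 0%E /\ (beta = 0 -> poincare_constant s A D = 0%E).
Proof.
move=> beta_ge0.
have [C C0 modC] := modular_cutoff_near; have [x0 Dx0] := D0.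
have [c c0 denc] := denominators_ge.
have modular0 f : (0 <= modular s A D f)%E by exact: modular_ge0.
have small : beta = 0 -> forall eta : R, 0 < eta -> \forall k \near \oo,
    (modular s A D (cutoff D M k.+1%:R^-1) <= (eta * c)%:E)%E.
  move=> beta0 eta eta0; have b0 : beta < eta * c / (C + 1).
    by rewrite beta0 divr_gt0 ?mulr_gt0// ltr_wpDl.
  apply: filterS (modC _ b0) => k /le_trans; apply; rewrite lee_fin.
  rewrite mulrA ler_pdivrMr ?ltr_wpDl// mulrC ler_wpM2l ?lerDl//.
  by rewrite mulr_ge0// ltW.
split; [|move=> beta0].
  apply: (ereal_inf_quotient0 (m := modular s A D) (d := fun f =>
      \int[@lebesgue_rV R n.+1]_(x in D) (A (`|f x| / dist_compl D x `^ s))%:E)%E)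
      => // [f|eta eta0].
    by apply: integral_ge0 => x _; exact: (hardy_density_ge0 s D AN).
  have [beta0|beta_neq0] := eqVneq beta 0.
    near \oo => k.
    exists (cutoff D M k.+1%:R^-1), (eta * c), c; split => //.
    - apply: (@cutoff_admissible x0); first by rewrite invr_gt0.
      by near: k; exact: cutoff_near1.
    - by near: k; exact: small.
    - by near: k; apply: filterS denc => k [].
  have beta0 : 0 < beta by rewrite lt_neqAle eq_sym beta_neq0.
  have [e0 e00 growth] := N_function_growth beta0.
  have b2 : 0 < beta / 2 by rewrite divr_gt0.
  pose a : R := C * (beta + 1).
  pose b : R := Num.max 1 (a / eta).
  have ab : a <= eta * b by rewrite mulrC -ler_pdivrMr// le_max lexx orbT.
  near \oo => k.
  exists (cutoff D M k.+1%:R^-1), a, b; split => //.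
  - apply: (@cutoff_admissible x0); first by rewrite invr_gt0.
    by near: k; exact: cutoff_near1.
  - by near: k; apply: modC; rewrite ltrDl.
  - by rewrite lt_max ltr01.
  - by near: k; exact: (hardy_denominator_near AN oD M0 DM b D0 e00 b2 growth).
apply: (ereal_inf_quotient0 (m := modular s A D) (d := fun f =>
    \int[@lebesgue_rV R n.+1]_(x in D) (A `|f x|)%:E)%E) => // [f|eta eta0].
  by apply: integral_ge0 => x _; exact: poincare_density_ge0.
near \oo => k.
exists (cutoff D M k.+1%:R^-1), (eta * c), c; split => //.
- apply: (@cutoff_admissible x0); first by rewrite invr_gt0.
  by near: k; exact: cutoff_near1.
- by near: k; exact: small.
- by near: k; apply: filterS denc => k [].
Unshelve. all: by end_near. Qed.

End lipschitz_domain_asymptotics.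

Theorem theorem1p3 (R : realType) (n : nat) (D : set 'rV[R]_n.+1) (s : R)
    (A : R -> R) (beta : R)
    (D_bounded : bounded_set D) (D_lipschitz : lipschitz_domain D)
    (s_gt0 : 0 < s) (s_lt1 : s < 1) (A_N_function : N_function A)
    (lim_beta :
      (eps%:E * \int[lebesgue_measure]_(z in `]0%R, (eps `^ (- s))%R]) (A z / z)%:E)%E
        @[eps --> (0 : R)^'+] --> beta%:E) :
  (beta = 0 ->
    [/\ ~ FOHI s A D, ~ RFOPI s A D,
        hardy_constant s A D = 0%E & poincare_constant s A D = 0%E]) /\
  (0 < beta -> ~ FOHI s A D /\ hardy_constant s A D = 0%E).
Proof.
have [M M0 DM] := bounded_norm_le D_bounded.
have main := sharp_constants_eq0 s_gt0 s_lt1 A_N_function M0 D_bounded D_lipschitz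
  DM lim_beta.
split=> beta0.
  have [|H0 P0] := main; first by rewrite beta0.
  by rewrite /FOHI /RFOPI H0 (P0 beta0) ltxx; split.
have [|H0 _] := main; first exact: ltW.
by rewrite /FOHI H0 ltxx; split.
Qed.
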